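(* Let $\mathcal{A}=\{A_1,\ldots,A_d\}$ be a commuting family of matrices $A_k\in\mathbb{C}^{n\times n}$, let $\boldsymbol\lambda=(\lambda_1,\ldots,\lambda_d)$ be a semisimple joint eigenvalue of $\mathcal{A}$ of multiplicity $p$, and let $X=[X_1\ X_2]\in\mathbb{C}^{n\times n}$, $Y=[Y_1\ Y_2]\in\mathbb{C}^{n\times n}$ be invertible matrices (with $X_1,Y_1\in\mathbb{C}^{n\times p}$) such that $$X_1^*X_1=I_p,\qquad Y^*X=I_n,\qquad Y^*A_kX=\begin{bmatrix}\lambda_kI_p&0\\0&A_{22}^{(k)}\end{bmatrix},\quad k=1,\ldots,d,$$ for some $A_{22}^{(k)}\in\mathbb{C}^{(n-p)\times(n-p)}$. Let $\mu\in\mathbb{C}^d$ with $\|\mu\|_2=1$ be such that $\lambda(\mu)=\sum_{k}\mu_k\lambda_k$ is not an eigenvalue of $A_{22}(\mu)=\sum_k\mu_kA_{22}^{(k)}$. Consider a perturbed family $\{\widetilde A_k=A_k+\epsilon E_k\}_{k=1}^d$ with $\|E_1\|_F^2+\cdots+\|E_d\|_F^2=1$ and $\epsilon>0$, such that the $p$ eigenvalues of $\widetilde A(\mu)=\sum_k\mu_k\widetilde A_k$ closest to $\lambda(\mu)$ remain semisimple. Suppose that $\widetilde X_1=[\widetilde x_1\ \cdots\ \widetilde x_p]$ and $\widetilde Y_1=[\widetilde y_1\ \cdots\ \widetilde y_p]$ contain the corresponding right/left eigenvectors of $\widetilde A(\mu)$, normalized such that $\widetilde Y_1^*\widetilde X_1=I_p$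 and the columns of $\widetilde X_1$ have norm $1$. Then the following hold. 1) The two-sided Rayleigh quotients $\widetilde{\boldsymbol\lambda}^{(i)}_{\mathrm{RQ2}}:=(\widetilde y_i^*\widetilde A_1\widetilde x_i,\ldots,\widetilde y_i^*\widetilde A_d\widetilde x_i)\in\mathbb{C}^d$ satisfy $$\|\widetilde{\boldsymbol\lambda}^{(i)}_{\mathrm{RQ2}}-\boldsymbol\lambda\|_2\le\|\widetilde y_i\|_2\,\epsilon+\mathcal{O}(\epsilon^2),\qquad i=1,\ldots,p.$$ 2) Additionally, assume that $\mathcal{A}$ is (simultaneously) diagonalizable and that $X=[X_1\ X_2]$, $Y=[Y_1\ Y_2]$ are such that $Y^*A_kX$ is diagonal for $k=1,\ldots,d$. Then the one-sided Rayleigh quotients $\widetilde{\boldsymbol\lambda}^{(i)}_{\mathrm{RQ1}}:=(\widetilde x_i^*\widetilde A_1\widetilde x_i,\ldots,\widetilde x_i^*\widetilde A_d\widetilde x_i)\in\mathbb{C}^d$ satisfy $$\|\widetilde{\boldsymbol\lambda}^{(i)}_{\mathrm{RQ1}}-\boldsymbol\lambda\|_2\le\Big(1+\frac{\sqrt d\,\|X_2\|_2\|Y_2\|_2}{d(\mu)}\Big)\epsilon+\mathcal{O}(\epsilon^2),\qquad i=1,\ldots,p,$$ where $$d(\mu):=\min_{\boldsymbol\lambda^{(j)}\ne\boldsymbol\lambda}\frac{|\lambda_j(\mu)-\lambda(\mu)|}{\|\boldsymbol\lambda^{(j)}-\boldsymbol\lambda\|_2},$$ $\boldsymbol\lambda^{(1)},\ldots,\boldsymbol\lambda^{(n)}$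 denote the joint eigenvalues of $\mathcal{A}$, and $\lambda_j(\mu)=\sum_{k=1}^d\mu_k\lambda^{(j)}_k$.
   Context: A family $\{A_1,\ldots,A_d\}\subset\mathbb{C}^{n\times n}$ is commuting if $A_jA_k=A_kA_j$ for all $j,k$. For such a family there is a unitary $U=[u_1\ \cdots\ u_n]$ such that all $U^*A_kU$ are upper triangular; the joint eigenvalues are the $n$ $d$-tuples $\boldsymbol\lambda^{(i)}=(\lambda^{(i)}_1,\ldots,\lambda^{(i)}_d)=(u_i^*A_1u_i,\ldots,u_i^*A_du_i)$, $i=1,\ldots,n$. The algebraic multiplicity of a joint eigenvalue $\boldsymbol\lambda$ is the number of times it occurs in this list; its geometric multiplicity is $\dim\bigcap_{k=1}^d\ker(A_k-\lambda_kI_n)$; $\boldsymbol\lambda$ is semisimple if the two multiplicities are equal. A family is simultaneously diagonalizable if there is an invertible $S$ with all $S^{-1}A_kS$ diagonal. $\|\cdot\|_2$ is the Euclidean/spectral norm, $\|\cdot\|_F$ the Frobenius norm, $^*$ the conjugate transpose. The columns of $\widetilde Y_1$ are left eigenvectors, i.e. $\widetilde y_i^*\widetilde A(\mu)=\theta_i\widetilde y_i^*$ and $\widetilde A(\mu)\widetilde x_i=\theta_i\widetilde x_i$ for the same eigenvalue $\theta_i$. The term $\mathcal{O}(\epsilon^2)$ is understood as $\epsilon\to0$ with all unperturbed data, the $E_k$ and $\mu$ fixed; the constant may depend on these (in particular on $\mu$). *)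

(* Defs.v *)
From HB Require Import structures.
From mathcomp Require Import all_boot all_order all_algebra.
From mathcomp Require Import all_classical all_reals all_analysis.
From mathcomp Require Import complex.

Set Implicit Arguments.
Unset Strict Implicit.
Unset Printing Implicit Defensive.

Import Order.TTheory GRing.Theory Num.Theory.
Import numFieldNormedType.Exports.

Local Open Scope classical_set_scope.
Local Open Scope ring_scope.
Local Open Scope complex_scope.
Local Open Scope sesquilinear_scope.

Section Norms.
Context {R : realType}.

(* Real-valued modulus; the library's `|z| lives in R[i]. *)
Definition cmod (z : R[i]) : R := complex.Re `|z|.

(* Frobenius norm; on row and column vectors it is the Euclidean norm. *)
Definition fnorm m n (A : 'M[R[i]]_(m, n)) : R :=
  Num.sqrt (\sum_(i < m) \sum_(j < n) cmod (A i j) ^+ 2).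

Definition spectral_norm m n (A : 'M[R[i]]_(m, n)) : R :=
  sup [set fnorm (A *m x) | x in [set x : 'cV[R[i]]_n | fnorm x <= 1]].

End Norms.

Section JointEigenvalues.
Context {R : realType} {n d : nat}.
Implicit Types (A : 'I_d -> 'M[R[i]]_n) (U : 'M[R[i]]_n) (lam : 'rV[R[i]]_d).

Definition commuting_family A := forall j k, comm_mx (A j) (A k).

(* is_trig_mx means lower triangular, hence the transpose. *)
Definition triangularizing_unitary A U :=
  U \is unitarymx /\ forall k, is_trig_mx (U ^t* *m A k *m U)^T.

Definition joint_eigenvalue A U (i : 'I_n) : 'rV[R[i]]_d :=
  \row_k ((col i U) ^t* *m A k *m col i U) 0 0.

Definition joint_algebraic_mult A U lam : nat :=
  #|[set i | joint_eigenvalue A U i == lam]|%SET.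

(* eigenspace is a space of row vectors; transposing gives the space of column
   vectors killed by all A k - lam k. *)
Definition joint_geometric_mult A lam : nat :=
  \rank (\bigcap_(k < d) eigenspace (A k)^T (lam 0 k))%MS.

Definition semisimple_joint_eigenvalue A U lam (p : nat) :=
  [/\ exists i, joint_eigenvalue A U i = lam,
      joint_algebraic_mult A U lam = p
    & joint_geometric_mult A lam = p].

Definition simultaneously_diagonalizable A :=
  exists2 S : 'M[R[i]]_n, S \in unitmx &
    forall k, is_diag_mx (invmx S *m A k *m S).

Definition mxcomb (mu : 'rV[R[i]]_d) A : 'M[R[i]]_n := \sum_k mu 0 k *: A k.

Definition vcomb (mu lam : 'rV[R[i]]_d) : R[i] := \sum_k mu 0 k * lam 0 k.

(* The minimum d(mu) over the joint eigenvalues different from lam. If there is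
   none, the extended minimum is +oo, fine +oo = 0, and a quotient by d(mu) is 0,
   in accordance with 1 / +oo = 0. *)
Definition joint_gap A U (lam mu : 'rV[R[i]]_d) : R :=
  fine (\big[Order.min/+oo%E]_(j < n | joint_eigenvalue A U j != lam)
    (cmod (vcomb mu (joint_eigenvalue A U j) - vcomb mu lam)
       / fnorm (joint_eigenvalue A U j - lam))%:E).

End JointEigenvalues.

Section Perturbation.
Context {R : realType}.

Definition perturbed d n (A E : 'I_d -> 'M[R[i]]_n) (eps : R) (k : 'I_d) :
  'M[R[i]]_n := A k + eps%:C *: E k.

(* theta lists, with algebraic multiplicities, p eigenvalues of M that are
   closest to z; theta' lists the remaining q ones. *)
Definition closest_eigenvalues p q (M : 'M[R[i]]_(p + q)) (z : R[i])
    (theta : 'I_p -> R[i]) :=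
  exists2 theta' : 'I_q -> R[i],
    char_poly M = \prod_i ('X - (theta i)%:P) * \prod_j ('X - (theta' j)%:P) &
    forall i j, cmod (theta i - z) <= cmod (theta' j - z).

Definition semisimple_eigenvalue n (M : 'M[R[i]]_n) (a : R[i]) :=
  eigenvalue M a /\ mup a (char_poly M) = \rank (eigenspace M^T a).

Definition normalized_eigenvectors n p (M : 'M[R[i]]_n) (theta : 'I_p -> R[i])
    (X Y : 'M[R[i]]_(n, p)) :=
  [/\ forall i, M *m col i X = theta i *: col i X,
      forall i, (col i Y) ^t* *m M = theta i *: (col i Y) ^t*,
      Y ^t* *m X = 1%:M
    & forall i, fnorm (col i X) = 1].

Definition closest_semisimple_eigenvectors p q (M : 'M[R[i]]_(p + q)) (z : R[i])
    (X Y : 'M[R[i]]_(p + q, p)) :=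
  exists theta : 'I_p -> R[i],
    [/\ closest_eigenvalues M z theta,
        forall i, semisimple_eigenvalue M (theta i)
      & normalized_eigenvectors M theta X Y].

Definition rayleigh d n (A : 'I_d -> 'M[R[i]]_n) (y x : 'cV[R[i]]_n) :
  'rV[R[i]]_d := \row_k (y ^t* *m A k *m x) 0 0.

End Perturbation.

(* Main.v *)
Require Import Defs.
From HB Require Import structures.
From mathcomp Require Import all_boot all_order all_algebra.
From mathcomp Require Import all_classical all_reals all_analysis.
From mathcomp Require Import complex ring lra.

Set Implicit Arguments.
Unset Strict Implicit.
Unset Printing Implicit Defensive.

Import Order.TTheory GRing.Theory Num.Theory.
Import numFieldNormedType.Exports.

Local Open Scope classical_set_scope.
Local Open Scope ring_scope.
Local Open Scope complex_scope.
Local Open Scope sesquilinear_scope.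

(** Write z for lambda(mu), X2 and Y2 for the complementary blocks, and M for the
    perturbed combination z + X2 D Y2' + eps E(mu), where ' is the conjugate
    transpose and D = A22(mu) - z is invertible. Each A_k equals
    lambda_k + X2 D_k Y2' with D_k = A22^(k) - lambda_k, so for eigenvectors x, y
    of M with y'x = 1 the k-th Rayleigh quotient misses lambda_k by
        (y'X2) D_k (Y2'x) + eps y'E_k x.

    Localization. The coefficients of the characteristic polynomial of M, expanded
    at z, are O(eps) below degree p, because X2 D Y2' has the eigenvalue 0 with
    multiplicity p. If one of the p eigenvalues closest to z stayed at distance r,
    then at least q + 1 of the p + q eigenvalues would; dividing the corresponding
    linear factors out keeps the low coefficients O(eps), yet the quotient is monic
    of degree p - 1, which is absurd (closest_eigenvalues_near).

    Eigenvectors. Projecting M x = theta x with Y2' and with Y1' gives, once theta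
    is near z, Y2'x = O(eps) and then theta - z = O(eps); on the adjoint side
    y'X2 = O(eps |y|) (closest_eigenvectors_bounds).

    Two-sided quotients. The product of the two offspace components is
    O(|y| eps^2), which is not O(eps^2) uniformly since |y| may blow up as eps
    tends to 0. If E(mu) = 0 it vanishes. Otherwise a large |y| is paid for by the
    first order term: sum_k |y'E_k x|^2 can be close to |y|^2 only if all the E_k
    are nearly multiples of y x', hence E(mu) nearly (y'E(mu)x / |y|^2) y x'
    (fnorm_mxcomb_aligned); but the eigenvalue equation makes y'E(mu)x bounded up to
    O(|y| eps), so for large |y| this would make E(mu) smaller than it is. The first
    order term is thus at most (1 - c) |y| eps with c > 0 fixed, which leaves room
    for the O(|y| eps^2) term (absorb_large_norm).

    One-sided quotients. With y = x of norm 1 only Y2'x must be expanded, to first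
    order Y2'x = - eps D^-1 Y2' E(mu) x. In the diagonal case D_k D^-1 has the
    entries (lambda^(j)_k - lambda_k) / (lambda_j(mu) - lambda(mu)), bounded by
    1 / d(mu) once the diagonal entries are recognized as joint eigenvalues and no
    joint eigenvalue other than lambda is mapped to lambda(mu)
    (joint_gap_bound, vcomb_neq_joint_eigenvalue). *)

(** * Modulus and Frobenius norm *)

Section FrobeniusNorm.
Context {R : realType}.

Lemma cauchy_schwarz_sum (I : finType) (a b : I -> R) :
  (\sum_i a i * b i) ^+ 2 <= (\sum_i a i ^+ 2) * (\sum_i b i ^+ 2).
Proof.
rewrite -subr_ge0.
(* Lagrange's identity. *)
have -> : (\sum_i a i ^+ 2) * (\sum_i b i ^+ 2) - (\sum_i a i * b i) ^+ 2 =
    2^-1 * \sum_i \sum_j (a i * b j - a j * b i) ^+ 2.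
  have -> : \sum_i \sum_j (a i * b j - a j * b i) ^+ 2 =
     \sum_i \sum_j (a i ^+ 2 * b j ^+ 2) + \sum_i \sum_j (a j ^+ 2 * b i ^+ 2)
     - 2 * \sum_i \sum_j (a i * b i) * (a j * b j).
    rewrite mulr_sumr -big_split -sumrB; apply: eq_bigr => i _ /=.
    rewrite mulr_sumr -big_split -sumrB; apply: eq_bigr => j _ /=.
    ring.
  rewrite [X in _ + X - _]exchange_big /= expr2 !big_distrlr /=.
  by field.
rewrite mulr_ge0 ?invr_ge0 // sumr_ge0 // => i _.
by rewrite sumr_ge0 // => j _; rewrite sqr_ge0.
Qed.

Lemma norm_cmod (z : R[i]) : `|z| = (cmod z)%:C.
Proof. by rewrite /cmod normc_def. Qed.

Lemma cmod_ge0 (z : R[i]) : 0 <= cmod z.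
Proof. by rewrite -ler0c -norm_cmod. Qed.

Lemma cmodM (z w : R[i]) : cmod (z * w) = cmod z * cmod w.
Proof. by apply: complexI; rewrite rmorphM -!norm_cmod normrM. Qed.

Lemma cmodD (z w : R[i]) : cmod (z + w) <= cmod z + cmod w.
Proof. by rewrite -lecR rmorphD -!norm_cmod /= ler_normD. Qed.

Lemma cmodN (z : R[i]) : cmod (- z) = cmod z.
Proof. by rewrite /cmod normrN. Qed.

Lemma cmod0 : cmod 0 = 0 :> R.
Proof. by rewrite /cmod normr0. Qed.

Lemma cmod1 : cmod 1 = 1 :> R.
Proof. by rewrite /cmod normr1. Qed.

Lemma cmod_eq0 (z : R[i]) : (cmod z == 0) = (z == 0).
Proof. by rewrite -(inj_eq (@complexI _)) -norm_cmod normr_eq0. Qed.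

Lemma cmodV (z : R[i]) : cmod z^-1 = (cmod z)^-1.
Proof. by apply: complexI; rewrite -norm_cmod normfV norm_cmod fmorphV. Qed.

Lemma cmodX (z : R[i]) n : cmod (z ^+ n) = cmod z ^+ n.
Proof. by apply: complexI; rewrite -norm_cmod normrX norm_cmod rmorphXn. Qed.

Lemma cmodJ (z : R[i]) : cmod (z^*)%R = cmod z.
Proof. by rewrite /cmod norm_conjC. Qed.

Lemma cmod_real (x : R) : cmod x%:C = `|x|.
Proof. by rewrite /cmod normc_def /= expr0n addr0 sqrtr_sqr. Qed.

Lemma cmod_sum (I : finType) (F : I -> R[i]) :
  cmod (\sum_i F i) <= \sum_i cmod (F i).
Proof.
elim/big_rec2: _ => [|i y x _ h]; first by rewrite cmod0.
by apply: le_trans (cmodD _ _) _; rewrite lerD2l.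
Qed.

Lemma cmod_sqr (z : R[i]) : (cmod z ^+ 2)%:C = z * (z^*)%R.
Proof. by rewrite rmorphXn /= -norm_cmod normCK. Qed.

Lemma fnorm_sqr m n (A : 'M[R[i]]_(m, n)) :
  fnorm A ^+ 2 = \sum_i \sum_j cmod (A i j) ^+ 2.
Proof.
by rewrite sqr_sqrtr // sumr_ge0 // => i _; rewrite sumr_ge0 // => j _; rewrite sqr_ge0.
Qed.

Lemma fnorm_sqr_pair m n (A : 'M[R[i]]_(m, n)) :
  fnorm A ^+ 2 = \sum_(k : 'I_m * 'I_n) cmod (A k.1 k.2) ^+ 2.
Proof. by rewrite fnorm_sqr pair_bigA. Qed.

Lemma fnorm_ge0 m n (A : 'M[R[i]]_(m, n)) : 0 <= fnorm A.
Proof. exact: sqrtr_ge0. Qed.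

Lemma fnorm_trmxC m n (A : 'M[R[i]]_(m, n)) : fnorm (A ^t*) = fnorm A.
Proof.
congr Num.sqrt; rewrite exchange_big; apply: eq_bigr => i _; apply: eq_bigr => j _ /=.
by rewrite !mxE cmodJ.
Qed.

Lemma fnormZ m n a (A : 'M[R[i]]_(m, n)) : fnorm (a *: A) = cmod a * fnorm A.
Proof.
apply: (pexpIrn (n := 2)) => //; rewrite ?nnegrE ?mulr_ge0 ?fnorm_ge0 ?cmod_ge0 //.
rewrite exprMn !fnorm_sqr mulr_sumr; apply: eq_bigr => i _.
by rewrite mulr_sumr; apply: eq_bigr => j _; rewrite mxE cmodM exprMn.
Qed.

Lemma fnormN m n (A : 'M[R[i]]_(m, n)) : fnorm (- A) = fnorm A.
Proof. by rewrite -scaleN1r fnormZ cmodN cmod1 mul1r. Qed.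

Lemma fnorm0 m n : fnorm (0 : 'M[R[i]]_(m, n)) = 0.
Proof. by rewrite -(scale0r (0 : 'M[R[i]]_(m, n))) fnormZ cmod0 mul0r. Qed.

Lemma fnorm11 (A : 'M[R[i]]_1) : fnorm A = cmod (A 0 0).
Proof. by rewrite /fnorm !big_ord1 sqrtr_sqr ger0_norm ?cmod_ge0. Qed.

Lemma fnormD m n (A B : 'M[R[i]]_(m, n)) : fnorm (A + B) <= fnorm A + fnorm B.
Proof.
rewrite -(@ler_pXn2r _ 2) ?nnegrE ?addr_ge0 ?fnorm_ge0 //.
have CS : \sum_(k : 'I_m * 'I_n) cmod (A k.1 k.2) * cmod (B k.1 k.2) <= fnorm A * fnorm B.
  rewrite -(@ler_pXn2r _ 2) ?nnegrE ?mulr_ge0 ?fnorm_ge0 ?sumr_ge0 //; last first.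
    by move=> i _; rewrite mulr_ge0 ?cmod_ge0.
  by rewrite exprMn !fnorm_sqr_pair; apply: cauchy_schwarz_sum.
apply: le_trans (_ : fnorm A ^+ 2 + 2 * (\sum_(k : 'I_m * 'I_n)
  cmod (A k.1 k.2) * cmod (B k.1 k.2)) + fnorm B ^+ 2 <= _); last by nra.
rewrite !fnorm_sqr_pair mulr_sumr -!big_split; apply: ler_sum => k _ /=.
rewrite mxE; have := cmodD (A k.1 k.2) (B k.1 k.2).
have := cmod_ge0 (A k.1 k.2 + B k.1 k.2); nra.
Qed.

Lemma fnormB m n (A B : 'M[R[i]]_(m, n)) : fnorm (A - B) <= fnorm A + fnorm B.
Proof. by rewrite -(fnormN B) fnormD. Qed.

Lemma fnormM m n r (A : 'M[R[i]]_(m, n)) (B : 'M[R[i]]_(n, r)) :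
  fnorm (A *m B) <= fnorm A * fnorm B.
Proof.
rewrite -(@ler_pXn2r _ 2) ?nnegrE ?mulr_ge0 ?fnorm_ge0 //.
rewrite exprMn !fnorm_sqr [X in _ * X]exchange_big /= big_distrlr /=.
apply: ler_sum => i _; apply: ler_sum => k _.
rewrite mxE; apply: le_trans (cauchy_schwarz_sum _ _).
rewrite ler_pXn2r ?nnegrE ?cmod_ge0 ?sumr_ge0 //.
  by apply: le_trans (cmod_sum _) _; apply: ler_sum => j _; rewrite cmodM.
by move=> j _; rewrite mulr_ge0 ?cmod_ge0.
Qed.

Lemma fnorm_eq0 m n (A : 'M[R[i]]_(m, n)) : (fnorm A == 0) = (A == 0).
Proof.
apply/eqP/eqP => [h|->]; last exact: fnorm0.
have /eqP := fnorm_sqr_pair A; rewrite h expr0n /= eq_sym.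
rewrite psumr_eq0; last by move=> *; rewrite sqr_ge0.
move=> /allP hA; apply/matrixP => i j; rewrite mxE.
have /implyP := hA (i, j) (mem_index_enum _); rewrite /= sqrf_eq0 cmod_eq0 => /(_ isT).
by move/eqP.
Qed.

Lemma fnorm_sqr_trace m n (A : 'M[R[i]]_(m, n)) :
  (fnorm A ^+ 2)%:C = \tr (A *m A ^t*).
Proof.
rewrite fnorm_sqr rmorph_sum; apply: eq_bigr => i _ /=.
rewrite rmorph_sum mxE; apply: eq_bigr => j _; rewrite !mxE.
exact: cmod_sqr.
Qed.

End FrobeniusNorm.

(** * Rayleigh rows, linear combinations and the spectral norm *)

Section RowsAndCombinations.
Context {R : realType}.

Lemma fnorm_row_sqr d (r : 'rV[R[i]]_d) :
  fnorm r ^+ 2 = \sum_k cmod (r 0 k) ^+ 2.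
Proof. by rewrite fnorm_sqr big_ord1. Qed.

Lemma trmxCM m n r (A : 'M[R[i]]_(m, n)) (B : 'M[R[i]]_(n, r)) :
  (A *m B) ^t* = B ^t* *m A ^t*.
Proof. by rewrite trmx_mul map_mxM. Qed.

Lemma trmxCZ m n a (A : 'M[R[i]]_(m, n)) : (a *: A) ^t* = (a^*)%R *: A ^t*.
Proof. by apply/matrixP => i j; rewrite !mxE rmorphM. Qed.

Lemma trmxCD m n (A B : 'M[R[i]]_(m, n)) : (A + B) ^t* = A ^t* + B ^t*.
Proof. by apply/matrixP => i j; rewrite !mxE rmorphD. Qed.

Lemma trmxCB m n (A B : 'M[R[i]]_(m, n)) : (A - B) ^t* = A ^t* - B ^t*.
Proof. by apply/matrixP => i j; rewrite !mxE rmorphB. Qed.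

Lemma cmod_form m n (u : 'rV[R[i]]_m) (B : 'M[R[i]]_(m, n)) (v : 'cV_n) :
  cmod ((u *m B *m v) 0 0) <= fnorm u * fnorm B * fnorm v.
Proof.
rewrite -fnorm11; apply: le_trans (fnormM _ _) _.
by rewrite ler_wpM2r ?fnorm_ge0 ?fnormM.
Qed.

Lemma fnorm_row_form d m n (u : 'rV[R[i]]_m) (B : 'I_d -> 'M[R[i]]_(m, n)) (v : 'cV_n) :
  fnorm (\row_k (u *m B k *m v) 0 0) <=
  fnorm u * Num.sqrt (\sum_k fnorm (B k) ^+ 2) * fnorm v.
Proof.
have s0 : 0 <= \sum_k fnorm (B k) ^+ 2 by rewrite sumr_ge0 // => k _; rewrite sqr_ge0.
rewrite -(@ler_pXn2r _ 2) ?nnegrE ?mulr_ge0 ?fnorm_ge0 ?sqrtr_ge0 //.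
rewrite !exprMn fnorm_row_sqr (sqr_sqrtr s0).
rewrite mulr_sumr mulr_suml; apply: ler_sum => k _.
by rewrite mxE -!exprMn ler_pXn2r ?nnegrE ?mulr_ge0 ?fnorm_ge0 ?cmod_ge0 ?cmod_form.
Qed.

Lemma fnorm_mxcomb d n (mu : 'rV[R[i]]_d) (B : 'I_d -> 'M[R[i]]_n) :
  fnorm (mxcomb mu B) <= fnorm mu * Num.sqrt (\sum_k fnorm (B k) ^+ 2).
Proof.
apply: le_trans (_ : \sum_k cmod (mu 0 k) * fnorm (B k) <= _).
  rewrite /mxcomb; elim/big_rec2: _ => [|k y x _ h]; first by rewrite fnorm0.
  by apply: le_trans (fnormD _ _) _; rewrite fnormZ lerD2l.
have s0 : 0 <= \sum_k fnorm (B k) ^+ 2 by rewrite sumr_ge0 // => k _; rewrite sqr_ge0.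
rewrite -(@ler_pXn2r _ 2) ?nnegrE ?mulr_ge0 ?fnorm_ge0 ?sqrtr_ge0 ?sumr_ge0 //; last first.
  by move=> k _; rewrite mulr_ge0 ?fnorm_ge0 ?cmod_ge0.
by rewrite exprMn fnorm_row_sqr (sqr_sqrtr s0) cauchy_schwarz_sum.
Qed.

Lemma trace_form m n (u : 'cV[R[i]]_m) (B : 'M[R[i]]_(m, n)) (v : 'cV_n) :
  \tr (B *m v *m u ^t*) = (u ^t* *m B *m v) 0 0.
Proof. by rewrite mxtrace_mulC mulmxA trace_mx11. Qed.

Lemma fnorm_col_sqr n (u : 'cV[R[i]]_n) : (u ^t* *m u) 0 0 = (fnorm u ^+ 2)%:C.
Proof. by rewrite fnorm_sqr_trace mxtrace_mulC trace_mx11. Qed.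

(** Pythagoras: the rank one matrix subtracted is the orthogonal projection
    of [B], for the Frobenius inner product, on the line spanned by [u v']. *)
Lemma fnorm_sub_rank1 m n (B : 'M[R[i]]_(m, n)) (u : 'cV_m) (v : 'cV_n) :
  fnorm v = 1 -> fnorm u != 0 ->
  fnorm (B - ((u ^t* *m B *m v) 0 0 / (fnorm u ^+ 2)%:C) *: (u *m v ^t*)) ^+ 2 =
  fnorm B ^+ 2 - (cmod ((u ^t* *m B *m v) 0 0) / fnorm u) ^+ 2.
Proof.
move=> v1 u0; set c := (_ *m _) 0 0; set N2 := (fnorm u ^+ 2)%:C.
have N20 : N2 != 0 by rewrite (inj_eq (@complexI _) _ 0) sqrf_eq0.
have N2J : (N2^*)%R = N2 by rewrite conj_Creal // complex_real.
apply: complexI; rewrite fnorm_sqr_trace trmxCB trmxCZ trmxCM trmxCK.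
rewrite mulmxBr !mulmxBl !raddfB /=.
rewrite -?scalemxAl -?scalemxAr -?scalemxAl !linearZ /=.
rewrite fnorm_sqr_trace.
have vv : v ^t* *m v = 1%:M.
  by apply/matrixP => i j; rewrite !ord1 fnorm_col_sqr v1 expr1n !mxE eqxx.
rewrite [B *m (v *m _)]mulmxA trace_form -/c.
have -> : \tr (u *m v ^t* *m B ^t*) = (c^*)%R.
  have -> : u *m v ^t* *m B ^t* = (B *m v *m u ^t*) ^t* by rewrite !trmxCM trmxCK mulmxA.
  by rewrite trace_map_mx mxtrace_tr trace_form.
have -> : \tr (u *m v ^t* *m (v *m u ^t*)) = N2.
  by rewrite mulmxA -(mulmxA u) vv mulmx1 mxtrace_mulC trace_mx11 fnorm_col_sqr.
have -> : ((c / N2)^*)%R = (c^*)%R / N2 by rewrite rmorphM fmorphV /= N2J.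
have -> : ((cmod c / fnorm u) ^+ 2)%:C = c * (c^*)%R / N2.
  by rewrite expr_div_n rmorphM fmorphV /= cmod_sqr.
have alg (F : fieldType) (T a b N : F) : N != 0 ->
    T + a / N * - b + (b / N * - a + a / N * (b / N * - - N)) = T - a * b / N.
  by move=> N0; field.
exact: alg.
Qed.

(** Subtracting from each [E k] its projection on [y x'] leaves residuals whose
    squared norms sum to the amount under the root; the projections combine to
    a multiple of [y x'] governed by the form of the combination itself. So if
    the Rayleigh row is almost as long as [y], the combination is almost
    determined by its own Rayleigh quotient. *)
Lemma fnorm_mxcomb_aligned d n (mu : 'rV[R[i]]_d) (E : 'I_d -> 'M[R[i]]_n)
    (y x : 'cV_n) :
  fnorm x = 1 -> fnorm y != 0 ->
  fnorm (mxcomb mu E) <= cmod ((y ^t* *m mxcomb mu E *m x) 0 0) / fnorm y +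
    fnorm mu * Num.sqrt (\sum_k fnorm (E k) ^+ 2
                           - (fnorm (rayleigh E y x) / fnorm y) ^+ 2).
Proof.
move=> x1 y0; set N2 := (fnorm y ^+ 2)%:C.
pose c k := (y ^t* *m E k *m x) 0 0.
pose F k := E k - (c k / N2) *: (y *m x ^t*).
have -> : (\sum_k fnorm (E k) ^+ 2 - (fnorm (rayleigh E y x) / fnorm y) ^+ 2) =
   \sum_k fnorm (F k) ^+ 2.
  rewrite expr_div_n fnorm_row_sqr mulr_suml -sumrB; apply: eq_bigr => k _.
  by rewrite /F fnorm_sub_rank1 // expr_div_n mxE.
have tE : (y ^t* *m mxcomb mu E *m x) 0 0 = \sum_k mu 0 k * c k.
  rewrite mulmx_sumr mulmx_suml summxE; apply: eq_bigr => k _.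
  by rewrite -scalemxAr -scalemxAl mxE.
set t := (_ *m _ *m _) 0 0 in tE *.
have EE : mxcomb mu E = (t / N2) *: (y *m x ^t*) + mxcomb mu F.
  rewrite tE mulr_suml scaler_suml -big_split; apply: eq_bigr => k _ /=.
  by rewrite -mulrA -scalerA -scalerDr addrC subrK.
rewrite {1}EE; apply: le_trans (fnormD _ _) _; apply: lerD; last exact: fnorm_mxcomb.
rewrite fnormZ cmodM cmodV -mulrA ler_wpM2l ?cmod_ge0 //.
have Np : 0 < fnorm y by rewrite lt_neqAle eq_sym y0 fnorm_ge0.
apply: le_trans (_ : (cmod N2)^-1 * (fnorm y * 1) <= _).
  by rewrite ler_wpM2l ?invr_ge0 ?cmod_ge0 // -x1 -(fnorm_trmxC x) fnormM.
by rewrite cmod_real ger0_norm ?exprn_ge0 ?fnorm_ge0 // mulr1 expr2 invfM mulfVK.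
Qed.

End RowsAndCombinations.

Section SpectralNorm.
Context {R : realType}.

Lemma spectral_norm_ub m n (A : 'M[R[i]]_(m, n)) (v : 'cV_n) :
  fnorm (A *m v) <= spectral_norm A * fnorm v.
Proof.
have [->|v0] := eqVneq v 0; first by rewrite mulmx0 !fnorm0 mulr0.
have Np : 0 < fnorm v by rewrite lt_neqAle eq_sym fnorm_eq0 v0 fnorm_ge0.
rewrite -ler_pdivrMr //.
have -> : fnorm (A *m v) / fnorm v = fnorm (A *m ((fnorm v)^-1%:C *: v)).
  by rewrite -scalemxAr fnormZ cmod_real ger0_norm ?invr_ge0 ?fnorm_ge0 // mulrC.
apply: ub_le_sup; last first.
  exists ((fnorm v)^-1%:C *: v) => //=.
  by rewrite fnormZ cmod_real ger0_norm ?invr_ge0 ?fnorm_ge0 // mulVf ?gt_eqF.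
exists (fnorm A) => _ [w /= w1 <-].
apply: le_trans (fnormM _ _) _.
by rewrite -[leRHS]mulr1 ler_wpM2l ?fnorm_ge0.
Qed.

Lemma spectral_norm_ge0 m n (A : 'M[R[i]]_(m, n)) : 0 <= spectral_norm A.
Proof.
apply: ub_le_sup; last by exists 0 => /=; rewrite ?mulmx0 ?fnorm0.
exists (fnorm A) => _ [w /= w1 <-].
apply: le_trans (fnormM _ _) _.
by rewrite -[leRHS]mulr1 ler_wpM2l ?fnorm_ge0.
Qed.

(** With [w = A' u] one has [|w|^2 = u' A w], and the spectral bound applies to
    [A w]: a matrix and its adjoint obey the same bound. *)
Lemma spectral_norm_adj_ub m n (A : 'M[R[i]]_(m, n)) (u : 'cV_m) :
  fnorm (A ^t* *m u) <= spectral_norm A * fnorm u.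
Proof.
set w := A ^t* *m u.
have [->|w0] := eqVneq w 0.
  by rewrite fnorm0 mulr_ge0 ?spectral_norm_ge0 ?fnorm_ge0.
have Np : 0 < fnorm w by rewrite lt_neqAle eq_sym fnorm_eq0 w0 fnorm_ge0.
rewrite -(ler_pM2l Np) -expr2.
have -> : fnorm w ^+ 2 = cmod ((u ^t* *m (A *m w)) 0 0).
  by rewrite mulmxA -[A]trmxCK -trmxCM fnorm_col_sqr cmod_real ger0_norm ?sqr_ge0.
rewrite -fnorm11; apply: le_trans (fnormM _ _) _.
rewrite fnorm_trmxC mulrA [leRHS]mulrC ler_wpM2l ?fnorm_ge0 // mulrC.
exact: spectral_norm_ub.
Qed.

End SpectralNorm.

(** * Characteristic polynomials and the localization of the closest eigenvalues *)

Section CharPolyPerturbation.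

Lemma char_poly_sub_scalar (F : comNzRingType) n (M : 'M[F]_n) (z : F) :
  char_poly (M - z%:M) = char_poly M \Po ('X + z%:P).
Proof.
rewrite /char_poly -[RHS](det_map_mx (comp_poly ('X + z%:P))).
congr (\det _); apply/matrixP => i j; rewrite !mxE /=.
rewrite comp_polyB comp_polyC polyCB opprB addrA.
case: (i == j) => /=; rewrite ?mulr1n ?mulr0n ?comp_polyX ?comp_poly0 ?polyC0; ring.
Qed.

Lemma char_poly_similar (F : comNzRingType) n (X Y B : 'M[F]_n) :
  Y *m X = 1%:M -> char_poly (X *m B *m Y) = char_poly B.
Proof.
move=> YX; have XY := mulmx1C YX.
rewrite /char_poly.
have -> : char_poly_mx (X *m B *m Y) =
    map_mx polyC X *m char_poly_mx B *m map_mx polyC Y.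
  rewrite /char_poly_mx mulmxBr mulmxBl !map_mxM; congr (_ - _).
  by rewrite scalar_mxC -mulmxA -map_mxM XY map_mx1 mulmx1.
rewrite !det_mulmx mulrAC -det_mulmx -map_mxM XY map_mx1 det1 mul1r.
by [].
Qed.

(** In the basis [X1, V] the matrix is block diagonal with blocks 0 and [D]. *)
Lemma char_poly_offspace (F : comNzRingType) p q (X1 : 'M[F]_(p + q, p))
    (V : 'M[F]_(p + q, q)) (Y1s : 'M[F]_(p, p + q)) (W : 'M[F]_(q, p + q)) (D : 'M[F]_q) :
  col_mx Y1s W *m row_mx X1 V = 1%:M ->
  char_poly (V *m D *m W) = 'X^p * char_poly D.
Proof.
move=> YX.
have -> : V *m D *m W = row_mx X1 V *m block_mx 0 0 0 D *m col_mx Y1s W.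
  by rewrite mul_row_block !mulmx0 !add0r mul_row_col mul0mx add0r.
rewrite char_poly_similar // /char_poly char_block_diag_mx det_lblock; congr (_ * _).
by rewrite /char_poly_mx map_mx0 subr0 det_scalar.
Qed.

Context {R : realType}.
Local Notation C := R[i].

(** The characteristic polynomial of a line of matrices is a polynomial in the
    parameter as well, so each coefficient moves by at most a multiple of it. *)
Lemma char_poly_coef_lipschitz n (B E : 'M[C]_n) (m : nat) :
  exists2 K : R, 0 <= K & forall (eps : R) k, 0 <= eps <= 1 -> (k < m)%N ->
    cmod ((char_poly (B + eps%:C *: E))`_k - (char_poly B)`_k) <= K * eps.
Proof.
(* The outer variable of P is the parameter, the inner one the spectral one. *)
pose P : {poly {poly C}} :=
  \det (map_mx polyC (char_poly_mx B) - 'X *: map_mx (polyC \o polyC) E).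
have PE (c : C) : P.[c%:P] = char_poly (B + c *: E).
  rewrite -horner_evalE -det_map_mx; congr (\det _).
  apply/matrixP => i j; rewrite !mxE /= /horner_eval hornerD hornerN hornerM !hornerC hornerX polyCD polyCM.
  by rewrite opprD addrA.
exists (\sum_(i < size P) \sum_(k < m) cmod (P`_i)`_k) => [|eps k /andP[e0 e1] km].
  by do 2![apply: sumr_ge0 => ? _]; rewrite cmod_ge0.
have -> : char_poly B = P.[0] by rewrite -polyC0 PE scale0r addr0.
rewrite -PE horner_coef horner_coef0 -coefB.
have -> : \sum_(i < size P) P`_i * eps%:C%:P ^+ i - P`_0 =
    \sum_(i < size P) P`_i * (eps%:C%:P ^+ i - (i == 0%N :> nat)%:R).
  rewrite (eq_bigr _ (fun i _ => mulrBr _ _ _)) sumrB; congr (_ - _).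
  have [s0|] := posnP (size P).
    by rewrite nth_default ?s0 // big1 // => -[].
  case: (size P) => // s _; rewrite big_ord_recl /= mulr1 big1 ?addr0 // => i _.
  by rewrite mulr0.
rewrite coef_sum; apply: le_trans (cmod_sum _) _.
rewrite mulr_suml; apply: ler_sum => i _.
have -> : eps%:C%:P ^+ i - (i == 0%N :> nat)%:R =
    (eps%:C ^+ i - (i == 0%N :> nat)%:R)%:P :> {poly C}.
  by rewrite polyCB polyC_exp -polyC_natr.
rewrite coefMC cmodM ler_pM ?cmod_ge0 //.
  rewrite (bigD1 (Ordinal km)) //= lerDl; apply: sumr_ge0 => ? _; exact: cmod_ge0.
case: (nat_of_ord i) => [|i'] /=; first by rewrite expr0 subrr cmod0.
rewrite subr0 cmodX cmod_real ger0_norm // exprS -[leRHS]mulr1.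
by rewrite ler_wpM2l // exprn_ile1.
Qed.

(** Division by [X - t] solves [Q_k = S_(k-1) - t S_k] upwards from the constant
    coefficient, and [t] is bounded away from 0. The ratio [2 / r] is chosen so
    that the bound [(e + e (2/r)^k) / r] is again of the form [e (2/r)^(k+1)]. *)
Lemma coef_div_XsubC_le (S : {poly C}) (t : C) (r e : R) m :
  0 < r <= 1 -> 0 <= e -> r <= cmod t ->
  (forall k, (k < m)%N -> cmod (S * ('X - t%:P))`_k <= e) ->
  forall k, (k < m)%N -> cmod S`_k <= e * (2 / r) ^+ m.
Proof.
move=> /andP[r0 r1] e0 rt he.
have s1 : 1 <= 2 / r by rewrite ler_pdivlMr //; lra.
have main k : (k < m)%N -> cmod S`_k <= e * (2 / r) ^+ k.+1.
  elim: k => [|k IH] km; have := he _ km; rewrite mulrBr coefB coefMX coefMC /=.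
    rewrite sub0r cmodN cmodM expr1 => h.
    have := cmod_ge0 S`_0; have -> : e * (2 / r) = e * 2 / r by rewrite mulrA.
    rewrite ler_pdivlMr //; nra.
  move=> h; have {}IH := IH (ltnW km).
  have h2 : cmod S`_k.+1 * cmod t <= e + cmod S`_k.
    rewrite -cmodM; apply: le_trans (_ : cmod (S`_k - (S`_k - S`_k.+1 * t)) <= _).
      by rewrite opprB addrCA subrr addr0.
    by apply: le_trans (cmodD _ _) _; rewrite cmodN addrC lerD2r.
  rewrite exprS.
  set s := (2 / r) ^+ k.+1 in IH *.
  have s_1 : 1 <= s by exact: exprn_ege1.
  have -> : e * (2 / r * s) = (2 * (e * s)) / r by ring.
  rewrite ler_pdivlMr //.
  have := cmod_ge0 S`_k.+1; nra.
move=> k km; apply: le_trans (main k km) _.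
by rewrite ler_wpM2l // ler_weXn2l.
Qed.

Lemma coef_div_prod_XsubC_le (ts : seq C) (S : {poly C}) (r e : R) m :
  0 < r <= 1 -> 0 <= e -> all (fun t => r <= cmod t) ts ->
  (forall k, (k < m)%N -> cmod (S * \prod_(t <- ts) ('X - t%:P))`_k <= e) ->
  forall k, (k < m)%N -> cmod S`_k <= e * ((2 / r) ^+ m) ^+ size ts.
Proof.
move=> hr; elim: ts S e => [|t ts IH] S e e0 /=.
  by move=> _ h k km; move: (h k km); rewrite big_nil !mulr1.
move=> /andP[rt rts] h k km.
rewrite exprSr mulrA.
apply: (coef_div_XsubC_le (t := t)) km => //.
  by rewrite mulr_ge0 // !exprn_ge0 // divr_ge0 // ltW //; case/andP: hr.
apply: IH => // j jm; have := h j jm.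
by rewrite big_cons mulrA.
Qed.

(** A far eigenvalue among the [p] closest ones makes the [q] others far too;
    the [q + 1] corresponding linear factors can be divided out, and the
    remaining monic factor of degree [p - 1] would have small coefficients. *)
Lemma closest_eigenvalues_near p q (X1 : 'M[C]_(p + q, p))
    (V : 'M[C]_(p + q, q)) (Y1s : 'M[C]_(p, p + q)) (W : 'M[C]_(q, p + q)) (D : 'M[C]_q)
    (E : 'M[C]_(p + q)) (z : C) (r : R) :
  col_mx Y1s W *m row_mx X1 V = 1%:M -> 0 < r ->
  exists2 e0 : R, 0 < e0 & forall eps, 0 < eps < e0 -> forall theta : 'I_p -> C,
    closest_eigenvalues (z%:M + V *m D *m W + eps%:C *: E) z theta ->
    forall i, cmod (theta i - z) <= r.
Proof.
move=> YX; wlog r1 : r / r <= 1 => [wl r0|r0].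
  have [||e0 e00 h] := wl (Num.min r 1); rewrite ?ge_min ?lexx ?orbT ?lt_min ?r0 ?ltr01 //.
  exists e0 => // eps he theta th i; apply: le_trans (h eps he theta th i) _.
  by rewrite ge_min lexx.
have [K K0 hK] := char_poly_coef_lipschitz (V *m D *m W) E p.
pose L := ((2 / r) ^+ p) ^+ q.+1.
have L0 : 0 <= L by rewrite !exprn_ge0 // divr_ge0 // ltW.
have KL0 : 0 < K * L + 1 by rewrite ltr_wpDl // mulr_ge0.
exists (K * L + 1)^-1; first by rewrite invr_gt0.
move=> eps /andP[eps0 epsK] theta [theta' char_eq close] i.
have eps1 : eps <= 1.
  by apply: ltW (lt_le_trans epsK _); rewrite invf_le1 // lerDr mulr_ge0.
rewrite leNgt; apply/negP => far.
pose ts := theta i - z :: [seq theta' j - z | j : 'I_q].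
pose S := \prod_(j | j != i) ('X - (theta j - z)%:P).
have fact : char_poly (V *m D *m W + eps%:C *: E) = S * \prod_(t <- ts) ('X - t%:P).
  have -> : V *m D *m W + eps%:C *: E =
      z%:M + V *m D *m W + eps%:C *: E - z%:M by rewrite -[z%:M + _ + _]addrA [RHS]addrC addKr.
  rewrite char_poly_sub_scalar char_eq comp_polyM !rmorph_prod /=.
  rewrite /ts big_cons big_image /= (bigD1 i) //= /S.
  have shift (t : C) : ('X - t%:P) \Po ('X + z%:P) = 'X - (t - z)%:P.
    by rewrite comp_polyB comp_polyX comp_polyC polyCB opprB addrA.
  rewrite shift (eq_bigr _ (fun j _ => shift (theta j))).
  by rewrite (eq_bigr _ (fun j _ => shift (theta' j))) [RHS]mulrCA mulrA.
have small k : (k < p)%N -> cmod (S * \prod_(t <- ts) ('X - t%:P))`_k <= K * eps.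
  move=> kp; have := hK eps k; rewrite eps1 ltW // => /(_ isT kp).
  by rewrite (char_poly_offspace _ YX) coefXnM kp subr0 fact.
have tsr : all (fun t => r <= cmod t) ts.
  rewrite /= ltW //=; apply/allP => _ /mapP[j _ ->].
  by apply: le_trans (close i j); rewrite ltW.
have r01 : 0 < r <= 1 by rewrite r0.
have Ke0 : 0 <= K * eps by rewrite mulr_ge0 // ltW.
have p0 : (p.-1 < p)%N by rewrite prednK ?leqnn // (leq_ltn_trans _ (ltn_ord i)).
have := coef_div_prod_XsubC_le r01 Ke0 tsr small p0.
have sizeS : size S = p.
  rewrite /S -big_filter -(big_map (fun j => theta j - z) xpredT (fun t => 'X - t%:P)).
  rewrite size_prod_XsubC size_map -cardE cardC1 card_ord prednK //.
  exact: leq_ltn_trans (leq0n i) (ltn_ord i).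
have Smon : S \is monic by apply: monic_prod => j _; exact: monicXsubC.
have -> : S`_p.-1 = 1 by rewrite -sizeS -lead_coefE (monicP Smon).
rewrite cmod1 /= size_map size_enum_ord -/L leNgt => /negP; apply.
move: epsK; rewrite -[ltRHS]div1r ltr_pdivlMr //; nra.
Qed.

End CharPolyPerturbation.

(** * First order bounds for eigenvalues and eigenvectors *)

Section EigenvectorIdentities.
Context {F : fieldType}.

(** Projecting the eigenvalue equation with [W] and dividing by [D] expresses the
    component outside the unperturbed eigenspace; the term in [th - z] is of
    second order, the other one is the first order change of the eigenvector. *)
Lemma eigvec_offspace n q (E : 'M[F]_n) (V : 'M[F]_(n, q)) (W : 'M[F]_(q, n))
    (D : 'M[F]_q) (z th eps : F) (x : 'cV[F]_n) :
  W *m V = 1%:M -> D \in unitmx -> (z%:M + V *m D *m W + eps *: E) *m x = th *: x ->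
  W *m x = (th - z) *: (invmx D *m (W *m x)) - eps *: (invmx D *m (W *m E *m x)).
Proof.
move=> WV Du Mx.
have h : W *m ((z%:M + V *m D *m W + eps *: E) *m x) = th *: (W *m x).
  by rewrite Mx -scalemxAr.
rewrite !mulmxDl !mulmxDr mul_scalar_mx -!scalemxAr -scalemxAl -!scalemxAr in h.
rewrite !mulmxA WV mul1mx in h.
have DW : D *m (W *m x) = (th - z) *: (W *m x) - eps *: (W *m E *m x).
  by rewrite scalerBl -h mulmxA addrAC addrK addrC addKr.
have := congr1 (mulmx (invmx D)) DW.
by rewrite (mulKmx Du) mulmxBr -!scalemxAr.
Qed.

Lemma eigvec_onspace n p q (E : 'M[F]_n) (V : 'M[F]_(n, q)) (W : 'M[F]_(q, n))
    (D : 'M[F]_q) (Y1s : 'M[F]_(p, n)) (z th eps : F) (x : 'cV[F]_n) :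
  Y1s *m V = 0 -> (z%:M + V *m D *m W + eps *: E) *m x = th *: x ->
  (th - z) *: (Y1s *m x) = eps *: (Y1s *m E *m x).
Proof.
move=> Y1V Mx.
have : Y1s *m ((z%:M + V *m D *m W + eps *: E) *m x) = th *: (Y1s *m x).
  by rewrite Mx -scalemxAr.
rewrite !mulmxDl !mulmxDr mul_scalar_mx -!scalemxAr -scalemxAl -!scalemxAr !mulmxA Y1V !mul0mx.
by rewrite addr0 scalerBl => <-; rewrite addrC addKr.
Qed.

End EigenvectorIdentities.

Section EigenvectorPerturbation.
Context {R : realType}.
Local Notation C := R[i].

Lemma fnorm_sub_scaled m n (a : C) (u v : 'M[C]_(m, n)) (eps : R) : 0 <= eps ->
  fnorm (a *: u - eps%:C *: v) <= cmod a * fnorm u + eps * fnorm v.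
Proof.
move=> e0; apply: le_trans (fnormB _ _) _.
by rewrite !fnormZ cmod_real ger0_norm.
Qed.

Lemma eigvec_offspace_le n q (E : 'M[C]_n) (V : 'M[C]_(n, q)) (W : 'M[C]_(q, n))
    (D : 'M[C]_q) (z th : C) (eps : R) (x : 'cV[C]_n) :
  W *m V = 1%:M -> D \in unitmx -> 0 <= eps ->
  (z%:M + V *m D *m W + eps%:C *: E) *m x = th *: x ->
  cmod (th - z) * fnorm (invmx D) <= 2^-1 ->
  fnorm (W *m x) <= 2 * fnorm (invmx D) * fnorm W * fnorm E * eps * fnorm x.
Proof.
move=> WV Du e0 Mx close.
have wE := eigvec_offspace WV Du Mx.
have h1 : cmod (th - z) * fnorm (invmx D *m (W *m x)) <= 2^-1 * fnorm (W *m x).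
  apply: le_trans (_ : cmod (th - z) * (fnorm (invmx D) * fnorm (W *m x)) <= _).
    by rewrite ler_wpM2l ?cmod_ge0 ?fnormM.
  by rewrite mulrA ler_wpM2r ?fnorm_ge0.
have h2 : fnorm (invmx D *m (W *m E *m x)) <=
    fnorm (invmx D) * (fnorm W * fnorm E * fnorm x).
  apply: le_trans (fnormM _ _) _; rewrite ler_wpM2l ?fnorm_ge0 //.
  by apply: le_trans (fnormM _ _) _; rewrite ler_wpM2r ?fnorm_ge0 ?fnormM.
have := fnorm_sub_scaled (th - z) (invmx D *m (W *m x)) (invmx D *m (W *m E *m x)) e0.
rewrite -wE.
move: h1 h2; move: (fnorm (invmx D *m (W *m E *m x))) (cmod _ * _) (fnorm (W *m x)).
move: (fnorm (invmx D)) (fnorm W) (fnorm E) (fnorm x) => a b c d v s w.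
move=> hs hv hw; have : eps * v <= eps * (a * (b * c * d)) by rewrite ler_wpM2l.
have -> : 2 * a * b * c * eps * d = 2 * (eps * (a * (b * c * d))) by ring.
lra.
Qed.

(** The adjoint family has the same form, with [V] and [W] exchanged. *)
Lemma left_eigvec_offspace_le n q (E : 'M[C]_n) (V : 'M[C]_(n, q)) (W : 'M[C]_(q, n))
    (D : 'M[C]_q) (z th : C) (eps : R) (y : 'cV[C]_n) :
  W *m V = 1%:M -> D \in unitmx -> 0 <= eps ->
  y ^t* *m (z%:M + V *m D *m W + eps%:C *: E) = th *: y ^t* ->
  cmod (th - z) * fnorm (invmx D) <= 2^-1 ->
  fnorm (y ^t* *m V) <= 2 * fnorm (invmx D) * fnorm V * fnorm E * eps * fnorm y.
Proof.
move=> WV Du e0 yM close.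
have DJ : invmx (D ^t*) = (invmx D) ^t* by rewrite trmx_inv map_invmx.
have -> : y ^t* *m V = (V ^t* *m y) ^t* by rewrite trmxCM trmxCK.
rewrite fnorm_trmxC -(fnorm_trmxC (invmx D)) -DJ -(fnorm_trmxC V) -(fnorm_trmxC E).
apply: (@eigvec_offspace_le _ _ _ (W ^t*) _ _ (z^*)%R (th^*)%R) => //.
- by rewrite -trmxCM WV tr_scalar_mx map_scalar_mx rmorph1.
- by rewrite map_unitmx unitmx_tr.
- have := congr1 (fun A => A ^t*) yM; rewrite trmxCM trmxCZ trmxCK => <-.
  rewrite !trmxCD !trmxCM trmxCZ tr_scalar_mx map_scalar_mx mulmxA.
  by rewrite [(_%:C^*)%R]conj_Creal // complex_real.
- by rewrite -rmorphB cmodJ DJ fnorm_trmxC.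
Qed.

(** The component of [x] in the unperturbed eigenspace keeps norm at least 1/2,
    so the projected equation bounds the eigenvalue shift itself. *)
Lemma eigval_shift_le p q (X1 : 'M[C]_(p + q, p))
    (V : 'M[C]_(p + q, q)) (Y1s : 'M[C]_(p, p + q)) (W : 'M[C]_(q, p + q)) (D : 'M[C]_q)
    (E : 'M[C]_(p + q)) (z th : C) (eps : R) (x : 'cV[C]_(p + q)) :
  col_mx Y1s W *m row_mx X1 V = 1%:M -> X1 ^t* *m X1 = 1%:M -> 0 <= eps ->
  (z%:M + V *m D *m W + eps%:C *: E) *m x = th *: x ->
  fnorm x = 1 -> fnorm V * fnorm (W *m x) <= 2^-1 ->
  cmod (th - z) <= 2 * fnorm Y1s * fnorm E * eps.
Proof.
move=> YX X11 e0 Mx x1 small.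
have XY := mulmx1C YX.
have Y1V : Y1s *m V = 0.
  by move: YX; rewrite mul_col_row scalar_mx_block => /eq_block_mx[].
have a_eq := eigvec_onspace Y1V Mx.
have a_large : 2^-1 <= fnorm (Y1s *m x).
  have xE : x = X1 *m (Y1s *m x) + V *m (W *m x).
    by rewrite -{1}[x]mul1mx -XY mul_row_col mulmxDl !mulmxA.
  have X1a : fnorm (X1 *m (Y1s *m x)) = fnorm (Y1s *m x).
    apply: (pexpIrn (n := 2)); rewrite ?nnegrE ?fnorm_ge0 //; apply: complexI.
    by rewrite -!fnorm_col_sqr trmxCM -mulmxA (mulmxA _ X1) X11 mul1mx.
  have := fnormD (X1 *m (Y1s *m x)) (V *m (W *m x)); rewrite -xE x1 X1a.
  have := fnormM V (W *m x); lra.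
have := congr1 (@fnorm _ _ _) a_eq; rewrite !fnormZ cmod_real (ger0_norm e0) => h.
have : fnorm (Y1s *m E *m x) <= fnorm Y1s * fnorm E.
  by apply: le_trans (fnormM _ _) _; rewrite x1 mulr1 fnormM.
move: h a_large; move: (cmod (th - z)) (cmod_ge0 (th - z)) (fnorm (Y1s *m x)) (fnorm (Y1s *m E *m x)).
move: (fnorm Y1s) (fnorm E) => a b t t0 u v h u2 hv.
have : t * 2^-1 <= t * u by rewrite ler_wpM2l.
have : eps * v <= eps * (a * b) by rewrite ler_wpM2l.
have -> : 2 * a * b * eps = 2 * (eps * (a * b)) by ring.
rewrite h; lra.
Qed.

(** The bound on [W x] keeps the factor [fnorm E], so that it gives exactly 0
    when the perturbation vanishes; the bound on the left eigenvector is only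
    relative to its norm, which has no bound uniform in [eps]. *)
Lemma closest_eigenvectors_bounds p q (X1 : 'M[C]_(p + q, p))
    (V : 'M[C]_(p + q, q)) (Y1s : 'M[C]_(p, p + q)) (W : 'M[C]_(q, p + q)) (D : 'M[C]_q)
    (E : 'M[C]_(p + q)) (z : C) :
  col_mx Y1s W *m row_mx X1 V = 1%:M -> X1 ^t* *m X1 = 1%:M -> D \in unitmx ->
  exists e0 K : R, [/\ 0 < e0, 0 <= K &
    forall eps, 0 < eps < e0 -> forall Xt Yt : 'M[C]_(p + q, p),
    closest_semisimple_eigenvectors (z%:M + V *m D *m W + eps%:C *: E) z Xt Yt ->
    forall i, exists th, let x := col i Xt in let y := col i Yt in
      [/\ fnorm x = 1, (y ^t* *m x) 0 0 = 1,
          (z%:M + V *m D *m W + eps%:C *: E) *m x = th *: x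
        & [/\ cmod (th - z) <= K * eps,
              fnorm (W *m x) <= K * fnorm E * eps
            & fnorm (y ^t* *m V) <= K * eps * fnorm y]]].
Proof.
move=> YX X11 Du.
have WV : W *m V = 1%:M.
  by move: YX; rewrite mul_col_row scalar_mx_block => /eq_block_mx[].
have I0 := fnorm_ge0 (invmx D).
(* Within distance r of z the resolvent of the block is controlled by |D^-1|. *)
pose r := (2 * (fnorm (invmx D) + 1))^-1.
have r0 : 0 < r by rewrite invr_gt0 mulr_gt0 // ltr_wpDl.
have rI : r * fnorm (invmx D) <= 2^-1.
  rewrite /r invfM -mulrA ler_piMr ?invr_ge0 //.
  by rewrite mulrC ler_pdivrMr ?mul1r ?lerDl ?ltr_wpDl.
have [e1 e10 near] := closest_eigenvalues_near D E z YX r0.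
pose K1 := 2 * fnorm (invmx D) * fnorm W.
pose K2 := 2 * fnorm (invmx D) * fnorm V * fnorm E.
pose K3 := 2 * fnorm Y1s * fnorm E.
have K10 : 0 <= K1 by rewrite !mulr_ge0 ?fnorm_ge0.
have K20 : 0 <= K2 by rewrite !mulr_ge0 ?fnorm_ge0.
have K30 : 0 <= K3 by rewrite !mulr_ge0 ?fnorm_ge0.
have e20 : 0 <= 2 * fnorm V * K1 * fnorm E by rewrite !mulr_ge0 ?fnorm_ge0.
pose e2 := (2 * fnorm V * K1 * fnorm E + 1)^-1.
exists (Num.min e1 e2), (K1 + K2 + K3); split.
- by rewrite lt_min e10 invr_gt0 ltr_wpDl.
- by rewrite !addr_ge0.
move=> eps; rewrite lt_min => /and3P[eps0 epse1 epse2] Xt Yt [theta [close _ [right left YtXt norm1]]] i.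
exists (theta i) => x y.
have e1' : 0 < eps < e1 by rewrite eps0.
have ni := near eps e1' theta close i.
have tI : cmod (theta i - z) * fnorm (invmx D) <= 2^-1.
  by apply: le_trans rI; rewrite ler_wpM2r.
have x1 : fnorm x = 1 by exact: norm1.
have Wx := eigvec_offspace_le WV Du (ltW eps0) (right i) tI.
have yV := left_eigvec_offspace_le WV Du (ltW eps0) (left i) tI.
move: Wx; rewrite x1 mulr1 -/x -/K1 => Wx.
have small : fnorm V * fnorm (W *m x) <= 2^-1.
  move: epse2; rewrite /e2 -[ltRHS]div1r ltr_pdivlMr ?ltr_wpDl // => h.
  have : fnorm V * fnorm (W *m x) <= fnorm V * (K1 * fnorm E * eps).
    by rewrite ler_wpM2l ?fnorm_ge0.
  lra.
have th := eigval_shift_le YX X11 (ltW eps0) (right i) x1 small.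
split; rewrite ?right //.
  transitivity ((Yt ^t* *m Xt) i i); last by rewrite YtXt mxE eqxx.
  by rewrite !mxE; apply: eq_bigr => j _; rewrite !mxE.
have e0 := ltW eps0; split.
- apply: le_trans th _; rewrite -/K3 ler_wpM2r //; lra.
- apply: le_trans Wx _; rewrite !ler_wpM2r ?fnorm_ge0 //; lra.
- apply: le_trans yV _; rewrite -/K2 !ler_wpM2r ?fnorm_ge0 //; lra.
Qed.

End EigenvectorPerturbation.

(** * Two-sided Rayleigh quotients *)

Section SpectralSplitting.
Context {F : fieldType}.

Lemma block_decomposition p q (X1 : 'M[F]_(p + q, p)) (V : 'M[F]_(p + q, q))
    (Y1s : 'M[F]_(p, p + q)) (W : 'M[F]_(q, p + q)) (A : 'M[F]_(p + q)) (l : F)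
    (B : 'M[F]_q) :
  col_mx Y1s W *m row_mx X1 V = 1%:M ->
  col_mx Y1s W *m A *m row_mx X1 V = block_mx l%:M 0 0 B ->
  A = l%:M + V *m (B - l%:M) *m W.
Proof.
move=> YX /(congr1 (fun M => row_mx X1 V *m M *m col_mx Y1s W)).
have XY := mulmx1C YX.
rewrite !mulmxA XY mul1mx -mulmxA XY mulmx1 => ->.
move: XY; rewrite mul_row_block mul_row_col !mulmx0 add0r addr0 mul_row_col.
move=> XY; rewrite mulmxBr mulmxBl !mul_mx_scalar -!scalemxAl.
rewrite -[in RHS](scalemx1 _ l) -XY scalerDr.
by rewrite -addrA [X in _ = _ + X]addrCA subrr addr0.
Qed.

Lemma sum_decomposition d n q (A E : 'I_d -> 'M[F]_n) (lam mu : 'I_d -> F)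
    (V : 'M[F]_(n, q)) (W : 'M[F]_(q, n)) (B : 'I_d -> 'M[F]_q) (eps : F) :
  (forall k, A k = (lam k)%:M + V *m (B k - (lam k)%:M) *m W) ->
  \sum_k mu k *: (A k + eps *: E k) =
  (\sum_k mu k * lam k)%:M
    + V *m (\sum_k mu k *: B k - (\sum_k mu k * lam k)%:M) *m W
    + eps *: \sum_k mu k *: E k.
Proof.
move=> hA.
have -> : \sum_k mu k *: B k - (\sum_k mu k * lam k)%:M =
    \sum_k mu k *: (B k - (lam k)%:M).
  rewrite raddf_sum -sumrB; apply: eq_bigr => k _.
  by rewrite scalerBr scale_scalar_mx.
rewrite raddf_sum mulmx_sumr mulmx_suml scaler_sumr -!big_split.
apply: eq_bigr => k _ /=.
rewrite hA -scalemxAr -scalemxAl.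
rewrite scalerDr [in LHS]scalerDr scale_scalar_mx.
by rewrite !scalerA (mulrC (mu k) eps).
Qed.

Lemma form_decomposition n q (E : 'M[F]_n) (V : 'M[F]_(n, q)) (W : 'M[F]_(q, n))
    (D : 'M[F]_q) (l eps : F) (y : 'rV[F]_n) (x : 'cV[F]_n) :
  (y *m (l%:M + V *m D *m W + eps *: E) *m x) 0 0 =
  l * (y *m x) 0 0 + (y *m V *m D *m (W *m x)) 0 0 + eps * (y *m E *m x) 0 0.
Proof.
rewrite !mulmxDr !mulmxDl mul_mx_scalar -scalemxAr -!scalemxAl !mulmxA.
by rewrite [LHS]mxE [X in X + _]mxE [X in X + _ + _]mxE [X in _ + X]mxE.
Qed.

End SpectralSplitting.

Section TwoSided.
Context {R : realType}.
Local Notation C := R[i].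

Lemma mxcomb_decomposition d p q (A E : 'I_d -> 'M[C]_(p + q)) (lam mu : 'rV[C]_d)
    (V : 'M[C]_(p + q, q)) (W : 'M[C]_(q, p + q)) (B : 'I_d -> 'M[C]_q) (eps : R) :
  (forall k, A k = (lam 0 k)%:M + V *m (B k - (lam 0 k)%:M) *m W) ->
  mxcomb mu (perturbed A E eps) =
  (vcomb mu lam)%:M + V *m (mxcomb mu B - (vcomb mu lam)%:M) *m W
    + eps%:C *: mxcomb mu E.
Proof. exact: sum_decomposition. Qed.

Lemma rayleigh_sub d p q (A E : 'I_d -> 'M[C]_(p + q)) (lam : 'rV[C]_d)
    (V : 'M[C]_(p + q, q)) (W : 'M[C]_(q, p + q)) (D : 'I_d -> 'M[C]_q) (eps : R)
    (x y : 'cV[C]_(p + q)) :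
  (forall k, A k = (lam 0 k)%:M + V *m D k *m W) -> (y ^t* *m x) 0 0 = 1 ->
  rayleigh (perturbed A E eps) y x - lam =
  \row_k (y ^t* *m V *m D k *m (W *m x)) 0 0 + eps%:C *: rayleigh E y x.
Proof.
move=> hA yx; apply/rowP => k.
rewrite [LHS]mxE [X in X + _]mxE [X in _ + X]mxE /perturbed hA.
rewrite [RHS]mxE [X in _ = X + _]mxE [X in _ = _ + X]mxE [X in _ = _ + _ * X]mxE.
by rewrite form_decomposition yx mulr1 addrAC [_ + _ - _]addrAC subrr add0r.
Qed.

Lemma near_right0 (P : R -> Prop) (e0 : R) : 0 < e0 ->
  (forall eps, 0 < eps < e0 -> P eps) -> \forall eps \near 0^'+, P eps.
Proof.
move=> e00 h; near=> eps; apply: h; apply/andP; split.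
  by near: eps; exact: nbhs_right_gt.
by near: eps; exact: nbhs_right_lt.
Unshelve. all: by end_near.
Qed.

(** Here [N] is the norm of the left eigenvector and [s] that of its Rayleigh row.
    For [N <= 4 K / eta] the term [c2 N eps^2] is a genuine [O(eps^2)]. For
    larger [N] the last hypothesis forces [s <= (1 - eta^2 / 8) N], and for
    [eps] this small the gain [eta^2 / 8 * N eps] covers [c2 N eps^2]. *)
Lemma absorb_large_norm (eta K c1 c2 eps N s : R) :
  0 < eta -> 0 <= K -> 0 <= c1 -> 0 <= c2 -> 0 < eps -> 0 < N -> 0 <= s <= N ->
  4 * c1 * eps <= eta -> 8 * c2 * eps <= eta ^+ 2 ->
  eta <= (K + c1 * N * eps) / N + Num.sqrt (1 - (s / N) ^+ 2) ->
  eps * s + c2 * N * eps ^+ 2 <= N * eps + c2 * (4 * K / eta) * eps ^+ 2.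
Proof.
move=> eta0 K0 c10 c20 eps0 N0 /andP[s0 sN] h1 h2 h.
have [small|large] := leP N (4 * K / eta).
  have : eps * s <= N * eps by rewrite mulrC ler_wpM2r // ltW.
  have : c2 * N * eps ^+ 2 <= c2 * (4 * K / eta) * eps ^+ 2.
    by rewrite ler_wpM2r ?sqr_ge0 // ler_wpM2l.
  lra.
have KN : K / N <= eta / 4.
  by rewrite ler_pdivrMr //; move: large; rewrite ltr_pdivrMr //; lra.
pose sg := s / N.
have sg0 : 0 <= sg by rewrite divr_ge0 // ltW.
have sg1 : sg <= 1 by rewrite ler_pdivrMr // mul1r.
have sq : eta / 2 <= Num.sqrt (1 - sg ^+ 2).
  move: h; rewrite mulrDl -[c1 * N * eps]mulrA (mulrC N) !mulrA mulfK ?gt_eqF // -/sg; lra.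
have sq2 : eta ^+ 2 / 4 <= 1 - sg ^+ 2.
  have nn : 0 <= 1 - sg ^+ 2 by rewrite subr_ge0 expr_le1.
  rewrite -(sqr_sqrtr nn).
  have -> : eta ^+ 2 / 4 = (eta / 2) ^+ 2 by field.
  by rewrite ler_pXn2r ?nnegrE ?sqrtr_ge0 // divr_ge0 // ltW.
have sgle : sg <= 1 - eta ^+ 2 / 8 by nra.
have sle : s <= (1 - eta ^+ 2 / 8) * N by rewrite -ler_pdivrMr.
have eN0 : 0 < eps * N by rewrite mulr_gt0.
have t1 : eps * s <= eps * ((1 - eta ^+ 2 / 8) * N) by rewrite ler_wpM2l // ltW.
have t2 : c2 * eps * (eps * N) <= eta ^+ 2 / 8 * (eps * N).
  by apply: ler_wpM2r; [exact: ltW | lra].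
have t3 : 0 <= c2 * (4 * K / eta) * eps ^+ 2.
  by rewrite !mulr_ge0 ?sqr_ge0 ?invr_ge0 // ltW.
have t4 : c2 * N * eps ^+ 2 = c2 * eps * (eps * N) by ring.
have t5 : eps * ((1 - eta ^+ 2 / 8) * N) = N * eps - eta ^+ 2 / 8 * (eps * N) by ring.
lra.
Qed.

Lemma two_sided_bound d p q (A E : 'I_d -> 'M[C]_(p + q)) (lam mu : 'rV[C]_d)
    (X1 : 'M[C]_(p + q, p)) (V : 'M[C]_(p + q, q))
    (Y1s : 'M[C]_(p, p + q)) (W : 'M[C]_(q, p + q)) (B : 'I_d -> 'M[C]_q) :
  col_mx Y1s W *m row_mx X1 V = 1%:M -> X1 ^t* *m X1 = 1%:M ->
  (forall k, A k = (lam 0 k)%:M + V *m (B k - (lam 0 k)%:M) *m W) ->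
  mxcomb mu B - (vcomb mu lam)%:M \in unitmx ->
  fnorm mu = 1 -> \sum_k fnorm (E k) ^+ 2 = 1 ->
  exists K : R, \forall eps \near 0^'+, forall Xt Yt : 'M[C]_(p + q, p),
    closest_semisimple_eigenvectors
      (mxcomb mu (perturbed A E eps)) (vcomb mu lam) Xt Yt ->
    forall i, fnorm (rayleigh (perturbed A E eps) (col i Yt) (col i Xt) - lam)
       <= fnorm (col i Yt) * eps + K * eps ^+ 2.
Proof.
move=> YX X11 hA Du mu1 E1.
set z := vcomb mu lam in Du *; set D := mxcomb mu B - z%:M in Du.
pose Emu := mxcomb mu E; pose eta := fnorm Emu.
have eta0 : 0 <= eta by exact: fnorm_ge0.
have [e0 [K [e00 K0 bounds]]] := closest_eigenvectors_bounds Emu z YX X11 Du.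
pose kap := Num.sqrt (\sum_k fnorm (B k - (lam 0 k)%:M) ^+ 2).
have kap0 : 0 <= kap by exact: sqrtr_ge0.
pose c1 := fnorm D * K ^+ 2 * eta.
have c10 : 0 <= c1 by rewrite !mulr_ge0 ?sqr_ge0 ?fnorm_ge0.
pose c2 := kap * K ^+ 2 * eta.
have c20 : 0 <= c2 by rewrite !mulr_ge0 ?sqr_ge0 ?fnorm_ge0.
have est (eps : R) Xt Yt i : 0 < eps < e0 ->
    closest_semisimple_eigenvectors (mxcomb mu (perturbed A E eps)) z Xt Yt ->
    let N := fnorm (col i Yt) in let s := fnorm (rayleigh E (col i Yt) (col i Xt)) in
    [/\ 0 < N, s <= N,
      fnorm (rayleigh (perturbed A E eps) (col i Yt) (col i Xt) - lam)
        <= eps * s + c2 * N * eps ^+ 2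
      & eta <= (K + c1 * N * eps) / N + Num.sqrt (1 - (s / N) ^+ 2)].
  move=> he; rewrite (mxcomb_decomposition E mu eps hA) -/z -/D -/Emu => hXY N s.
  have [th [x1 yx Mx [hth hW hV]]] := bounds eps he Xt Yt hXY i.
  have /andP[eps0 _] := he.
  have N0 : 0 < N.
    rewrite lt_neqAle fnorm_ge0 andbT eq_sym; apply: contra_eq_neq yx.
    by move=> /eqP; rewrite fnorm_eq0 => /eqP->; rewrite trmx0 map_mx0 mul0mx mxE eq_sym oner_eq0.
  have yVWx : fnorm (col i Yt ^t* *m V) * fnorm (W *m col i Xt) <=
      (K ^+ 2 * eta) * N * eps ^+ 2.
    apply: le_trans (_ : (K * eps * N) * (K * eta * eps) <= _).
      by rewrite ler_pM ?fnorm_ge0.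
    by rewrite le_eqVlt; apply/orP; left; apply/eqP; ring.
  split=> //.
  - apply: le_trans (fnorm_row_form _ _ _) _.
    by rewrite fnorm_trmxC E1 sqrtr1 mulr1 x1 mulr1.
  - rewrite (rayleigh_sub E eps hA yx); apply: le_trans (fnormD _ _) _.
    rewrite addrC fnormZ cmod_real gtr0_norm // lerD2l.
    apply: le_trans (fnorm_row_form _ _ _) _; rewrite -/kap.
    rewrite [leLHS]mulrAC [leLHS]mulrC.
    apply: le_trans (_ : kap * (K ^+ 2 * eta * N * eps ^+ 2) <= _).
      by rewrite ler_wpM2l.
    by rewrite /c2 !mulrA.
  have := fnorm_mxcomb_aligned mu E x1 (lt0r_neq0 N0).
  rewrite -/Emu -/eta -/N -/s mu1 mul1r E1 => al; apply: le_trans al _.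
  rewrite lerD2r ler_pM2r ?invr_gt0 //.
  set t := (_ *m _) 0 0.
  have tE : eps%:C * t = (th - z) - (col i Yt ^t* *m V *m D *m (W *m col i Xt)) 0 0.
    have := congr1 (fun M => (col i Yt ^t* *m M) 0 0) Mx.
    rewrite -scalemxAr [in RHS]mxE yx mulr1.
    rewrite mulmxA form_decomposition yx mulr1 -/t => <-; ring.
  have : eps * cmod t <= eps * (K + c1 * N * eps).
    have -> : eps * cmod t = cmod (eps%:C * t) by rewrite cmodM cmod_real gtr0_norm.
    rewrite tE; apply: le_trans (cmodD _ _) _; rewrite cmodN mulrDr.
    apply: lerD; first by rewrite mulrC.
    apply: le_trans (cmod_form _ _ _) _.
    rewrite [leLHS]mulrAC [leLHS]mulrC.
    apply: le_trans (_ : fnorm D * (K ^+ 2 * eta * N * eps ^+ 2) <= _).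
      by rewrite ler_wpM2l ?fnorm_ge0.
    by rewrite le_eqVlt; apply/orP; left; apply/eqP; rewrite /c1; ring.
  by rewrite ler_pM2l.
(* If the combination E(mu) vanishes, x lies in the unperturbed eigenspace and
   the second order term is 0, however large y is. *)
have [eta_eq0|eta_neq0] := eqVneq eta 0.
  exists 0; apply: (near_right0 e00) => eps he Xt Yt hXY i.
  have [N0 sN rq _] := est eps Xt Yt i he hXY.
  apply: le_trans rq _; rewrite /c2 eta_eq0 !(mulr0, mul0r) !addr0 mulrC.
  by rewrite ler_wpM2r // ltW //; case/andP: he.
have etap : 0 < eta by rewrite lt_neqAle eq_sym eta_neq0.
exists (c2 * (4 * K / eta)).
pose e1 := eta / (4 * c1 + 1); pose e2 := eta ^+ 2 / (8 * c2 + 1).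
have p1 : 0 < 4 * c1 + 1 by lra.
have p2 : 0 < 8 * c2 + 1 by lra.
apply: (@near_right0 _ (Num.min e0 (Num.min e1 e2))).
  by rewrite !lt_min e00 !divr_gt0 ?exprn_gt0.
move=> eps; rewrite !lt_min => /and4P[eps0 h0 h1 h2] Xt Yt hXY i.
have he : 0 < eps < e0 by rewrite eps0.
have [N0 sN rq al] := est eps Xt Yt i he hXY.
apply: le_trans rq _; apply: (absorb_large_norm etap K0 c10 c20) al => //.
- by rewrite fnorm_ge0.
- by move: h1; rewrite ltr_pdivlMr //; lra.
- by move: h2; rewrite ltr_pdivlMr //; lra.
Qed.

End TwoSided.

(** * One-sided Rayleigh quotients *)

Section OneSided.
Context {R : realType}.
Local Notation C := R[i].

Lemma fnorm_diag_mul_le q (M D : 'M[C]_q) (g : R) (u : 'cV[C]_q) :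
  0 <= g -> is_diag_mx M -> is_diag_mx D ->
  (forall j, cmod (M j j) <= g * cmod (D j j)) ->
  fnorm (M *m u) <= g * fnorm (D *m u).
Proof.
move=> g0 /is_diag_mxP Md /is_diag_mxP Dd h.
have diagE (N : 'M[C]_q) : (forall i j : 'I_q, i != j :> nat -> N i j = 0) ->
    forall i, (N *m u) i 0 = N i i * u i 0.
  move=> Nd i; rewrite mxE (bigD1 i) //= big1 ?addr0 // => j ji.
  by rewrite Nd ?mul0r // eq_sym.
rewrite -(@ler_pXn2r _ 2) ?nnegrE ?mulr_ge0 ?fnorm_ge0 //.
rewrite exprMn !fnorm_sqr mulr_sumr; apply: ler_sum => i _; rewrite !big_ord1.
rewrite (diagE M Md) (diagE D Dd).
rewrite !cmodM -exprMn ler_pXn2r ?nnegrE ?mulr_ge0 ?cmod_ge0 //.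
by rewrite mulrA ler_wpM2r ?cmod_ge0.
Qed.

Lemma fnorm_row_le d (r : 'rV[C]_d) (m : R) :
  0 <= m -> (forall k, cmod (r 0 k) <= m) -> fnorm r <= Num.sqrt d%:R * m.
Proof.
move=> m0 h; rewrite -(@ler_pXn2r _ 2) ?nnegrE ?mulr_ge0 ?fnorm_ge0 ?sqrtr_ge0 //.
rewrite exprMn fnorm_row_sqr sqr_sqrtr ?ler0n //.
apply: le_trans (_ : \sum_(k < d) m ^+ 2 <= _).
  by apply: ler_sum => k _; rewrite ler_pXn2r ?nnegrE ?cmod_ge0.
by rewrite sumr_const card_ord mulr_natl.
Qed.

Lemma row_form_sub d m n (y : 'rV[C]_m) (D : 'I_d -> 'M[C]_(m, n)) (u v : 'cV[C]_n) (a : C) :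
  \row_k (y *m D k *m (u - a *: v)) 0 0 =
  \row_k (y *m D k *m u) 0 0 - a *: \row_k (y *m D k *m v) 0 0.
Proof.
apply/rowP => k; rewrite [LHS]mxE [RHS]mxE [X in _ = X + _]mxE [X in _ = _ + X]mxE.
rewrite [X in _ = _ - X]mxE [X in _ = _ - _ * X]mxE.
by rewrite mulmxBr -scalemxAr [LHS]mxE [X in _ + X]mxE; congr (_ - _); rewrite [LHS]mxE.
Qed.

(** The component [W x] is split in [w1], of second order, and [- eps u], where [u]
    is bounded independently of [eps]. The row formed with [V D_k u] is bounded
    entry by entry, whence the factor [sqrt d]. *)
Lemma one_sided_bound d p q (A E : 'I_d -> 'M[C]_(p + q)) (lam mu : 'rV[C]_d)
    (X1 : 'M[C]_(p + q, p)) (V Y2 : 'M[C]_(p + q, q))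
    (Y1s : 'M[C]_(p, p + q)) (B : 'I_d -> 'M[C]_q) (g : R) :
  let D := mxcomb mu B - (vcomb mu lam)%:M in
  col_mx Y1s (Y2 ^t*) *m row_mx X1 V = 1%:M -> X1 ^t* *m X1 = 1%:M ->
  (forall k, A k = (lam 0 k)%:M + V *m (B k - (lam 0 k)%:M) *m Y2 ^t*) ->
  D \in unitmx -> (forall k, is_diag_mx (B k)) ->
  0 <= g -> (forall k j, cmod (B k j j - lam 0 k) <= g * cmod (D j j)) ->
  fnorm mu = 1 -> \sum_k fnorm (E k) ^+ 2 = 1 ->
  exists K : R, \forall eps \near 0^'+, forall Xt Yt : 'M[C]_(p + q, p),
    closest_semisimple_eigenvectors
      (mxcomb mu (perturbed A E eps)) (vcomb mu lam) Xt Yt ->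
    forall i, fnorm (rayleigh (perturbed A E eps) (col i Xt) (col i Xt) - lam)
       <= (1 + Num.sqrt d%:R * spectral_norm V * spectral_norm Y2 * g) * eps
          + K * eps ^+ 2.
Proof.
move=> D YX X11 hA Du Bdiag g0 hg mu1 E1.
set z := vcomb mu lam in D Du hg *; set W := Y2 ^t* in YX hA.
have WV : W *m V = 1%:M.
  by move: YX; rewrite mul_col_row scalar_mx_block => /eq_block_mx[].
pose Emu := mxcomb mu E; pose Dk k := B k - (lam 0 k)%:M.
have Emu1 : fnorm Emu <= 1.
  by apply: le_trans (fnorm_mxcomb _ _) _; rewrite mu1 E1 sqrtr1 mulr1.
have [e0 [K [e00 K0 bounds]]] := closest_eigenvectors_bounds Emu z YX X11 Du.
pose kap := Num.sqrt (\sum_k fnorm (Dk k) ^+ 2).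
have kap0 : 0 <= kap by exact: sqrtr_ge0.
have subdiag (M : 'M[C]_q) a : is_diag_mx M -> is_diag_mx (M - a%:M).
  move=> /is_diag_mxP Md; apply/is_diag_mxP => i j ij.
  by rewrite !mxE Md // sub0r -val_eqE /= (negbTE ij) mulr0n oppr0.
have Dkdiag k : is_diag_mx (Dk k) by exact: subdiag.
have Ddiag : is_diag_mx D.
  apply: subdiag; apply/is_diag_mxP => i j ij; rewrite /mxcomb summxE big1 // => k _.
  by rewrite mxE (is_diag_mxP (Bdiag k)) // mulr0.
exists (fnorm V * kap * (K * fnorm (invmx D) * (K * fnorm Emu))).
apply: (near_right0 e00) => eps he Xt Yt hXY i.
move: hXY; rewrite (mxcomb_decomposition E mu eps hA) -/z -/D -/Emu => hXY.
have [th [x1 _ Mx [hth hW _]]] := bounds eps he Xt Yt hXY i.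
have /andP[eps0 _] := he.
set x := col i Xt in x1 Mx hW *.
have xx : (x ^t* *m x) 0 0 = 1 by rewrite fnorm_col_sqr x1 expr1n.
rewrite (rayleigh_sub E eps hA xx) (eigvec_offspace WV Du Mx).
(* w1 is of second order: theta - z and W x are both O(eps). *)
set w1 := _ *: (invmx D *m _); set u := invmx D *m (_ *m x).
rewrite row_form_sub.
have b1 : fnorm (\row_k (x ^t* *m V *m Dk k *m w1) 0 0) <=
    fnorm V * kap * (K * fnorm (invmx D) * (K * fnorm Emu)) * eps ^+ 2.
  apply: le_trans (fnorm_row_form _ _ _) _; rewrite -/kap.
  apply: le_trans (_ : fnorm V * kap * (K * eps * (fnorm (invmx D) * (K * fnorm Emu * eps))) <= _).
    apply: ler_pM; rewrite ?mulr_ge0 ?fnorm_ge0 //.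
      rewrite ler_wpM2r //; apply: le_trans (fnormM _ _) _.
      by rewrite fnorm_trmxC x1 mul1r.
    rewrite fnormZ ler_pM ?cmod_ge0 ?fnorm_ge0 //.
    by apply: le_trans (fnormM _ _) _; rewrite ler_wpM2l ?fnorm_ge0.
  by rewrite le_eqVlt; apply/orP; left; apply/eqP; ring.
have b2 : fnorm (\row_k (x ^t* *m V *m Dk k *m u) 0 0) <=
    Num.sqrt d%:R * (spectral_norm V * (g * spectral_norm Y2)).
  apply: fnorm_row_le => [|k]; first by rewrite !mulr_ge0 ?spectral_norm_ge0.
  rewrite mxE -fnorm11 -!mulmxA; apply: le_trans (fnormM _ _) _.
  rewrite fnorm_trmxC x1 mul1r; apply: le_trans (spectral_norm_ub _ _) _.
  rewrite ler_wpM2l ?spectral_norm_ge0 //.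
  apply: le_trans (fnorm_diag_mul_le u g0 (Dkdiag k) Ddiag _) _.
    by move=> j; have := hg k j; rewrite /Dk !mxE eqxx mulr1n.
  rewrite /u mulKVmx // ler_wpM2l // -mulmxA.
  apply: le_trans (spectral_norm_adj_ub _ _) _.
  rewrite ler_piMr ?spectral_norm_ge0 //.
  by apply: le_trans (fnormM _ _) _; rewrite x1 mulr1.
have b3 : fnorm (rayleigh E x x) <= 1.
  apply: le_trans (fnorm_row_form _ _ _) _.
  by rewrite fnorm_trmxC E1 sqrtr1 mulr1 x1 mulr1.
apply: le_trans (fnormD _ _) _; rewrite fnormZ cmod_real gtr0_norm //.
have b4 := @fnormB _ _ _ (\row_k (x ^t* *m V *m Dk k *m w1) 0 0)
   (eps%:C *: \row_k (x ^t* *m V *m Dk k *m u) 0 0).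
rewrite [X in _ <= _ + X]fnormZ cmod_real gtr0_norm // in b4.
apply: le_trans (_ : _ <= fnorm (\row_k (x ^t* *m V *m Dk k *m w1) 0 0)
  + eps * fnorm (\row_k (x ^t* *m V *m Dk k *m u) 0 0) + eps * fnorm (rayleigh E x x)) _.
  by rewrite lerD2r.
have eps_ge0 := ltW eps0.
have c2 := ler_wpM2l eps_ge0 b2; have c3 := ler_wpM2l eps_ge0 b3.
apply: le_trans (lerD (lerD b1 c2) c3) _.
move: (Num.sqrt _) (spectral_norm V) (spectral_norm Y2) => sd sV sY.
move: (fnorm V) (fnorm (invmx D)) (fnorm Emu) => fV fI fE.
by rewrite le_eqVlt; apply/orP; left; apply/eqP; ring.
Qed.

End OneSided.

(** * Joint eigenvalues and the gap *)

Section JointEigenvaluesTheory.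
Context {R : realType}.
Local Notation C := R[i].

Lemma joint_eigenvalueE d n (A : 'I_d -> 'M[C]_n) U i k :
  joint_eigenvalue A U i 0 k = (U ^t* *m A k *m U) i i.
Proof.
rewrite mxE; have -> : (col i U) ^t* = row i (U ^t*).
  by apply/matrixP => a b; rewrite !mxE.
rewrite -row_mul [LHS]mxE [RHS]mxE; apply: eq_bigr => l _.
by rewrite [X in X * _]mxE [X in _ * X]mxE.
Qed.

(** At the last nonzero entry of [w] an upper triangular matrix acts through its
    diagonal entry alone. *)
Lemma trig_eigvec_diag n (T : 'M[C]_n) (w : 'cV[C]_n) (j : 'I_n) (a : C) :
  is_trig_mx T^T -> T *m w = a *: w -> w j 0 != 0 ->
  (forall i : 'I_n, (j < i)%N -> w i 0 = 0) -> a = T j j.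
Proof.
move=> /is_trig_mxP Tt Tw wj last.
have /(congr1 (fun M : 'cV_n => M j 0)) := Tw.
rewrite !mxE (bigD1 j) //= big1 => [|i ij]; last first.
  case: (ltngtP i j) => [lt|gt|/val_inj e]; last by rewrite e eqxx in ij.
    by have := Tt _ _ lt; rewrite mxE => ->; rewrite mul0r.
  by rewrite last ?mulr0.
by rewrite addr0 => /(mulIf wj).
Qed.

(** The index of the last nonzero entry of [U' v] depends only on [v], so it
    serves all members of the family at once. *)
Lemma joint_eigenvalue_of_eigvec d n (A : 'I_d -> 'M[C]_n) U (nu : 'rV[C]_d)
    (v : 'cV[C]_n) :
  triangularizing_unitary A U -> v != 0 -> (forall k, A k *m v = nu 0 k *: v) ->
  exists j, joint_eigenvalue A U j = nu.
Proof.
move=> [/unitarymxP UU Ut] v0 Av.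
pose w := U ^t* *m v.
have [j0 wj0] : exists j, w j 0 != 0.
  apply/existsP; apply: contra_neqT v0; rewrite negb_exists => /forallP w0.
  have w_eq0 : w = 0.
    by apply/colP => j; rewrite [RHS]mxE; apply/eqP; have := w0 j; rewrite negbK.
  by rewrite -[v]mul1mx -UU -mulmxA -/w w_eq0 mulmx0.
case: (arg_maxnP (P := fun j => w j 0 != 0) (fun j : 'I_n => j : nat) wj0) => j wj jmax.
exists j; apply/rowP => k; rewrite joint_eigenvalueE; apply/esym.
apply: (trig_eigvec_diag (w := w)) wj _ => [|| i ji]; first exact: Ut.
  by rewrite /w !mulmxA -(mulmxA _ U) UU mulmx1 -!mulmxA Av -scalemxAr.
by apply/eqP; apply: contraLR ji => wi; rewrite -leqNgt; apply: jmax.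
Qed.

Lemma char_poly_mxcomb d n (A : 'I_d -> 'M[C]_n) U (mu : 'rV[C]_d) (z : C) :
  triangularizing_unitary A U ->
  char_poly (mxcomb mu A - z%:M) =
  \prod_j ('X - (vcomb mu (joint_eigenvalue A U j) - z)%:P).
Proof.
move=> [/unitarymxP UU Ut].
pose T := U ^t* *m (mxcomb mu A - z%:M) *m U.
have -> : mxcomb mu A - z%:M = U *m T *m U ^t*.
  by rewrite /T !mulmxA UU mul1mx -mulmxA UU mulmx1.
rewrite (char_poly_similar _ (mulmx1C UU)) -[T]trmxK.
have TE : T = \sum_k mu 0 k *: (U ^t* *m A k *m U) - z%:M.
  rewrite /T mulmxBr mulmxBl mul_mx_scalar -scalemxAl (mulmx1C UU) scalemx1.
  rewrite mulmx_sumr mulmx_suml; congr (_ - _).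
  by apply: eq_bigr => k _; rewrite -scalemxAr -scalemxAl.
have -> : char_poly T^T^T = char_poly T^T.
  rewrite /char_poly -[RHS]det_tr; congr (\det _).
  by apply/matrixP => i j; rewrite !mxE eq_sym.
rewrite char_poly_trig.
  apply: eq_bigr => j _; rewrite mxE TE; congr ('X - _%:P).
  rewrite !mxE eqxx mulr1n summxE; congr (_ - _).
  by apply: eq_bigr => k _; rewrite mxE joint_eigenvalueE.
apply/is_trig_mxP => i j ij; rewrite mxE TE !mxE summxE big1.
  by rewrite -val_eqE /= gtn_eqF // mulr0n subr0.
move=> k _; rewrite mxE; have /is_trig_mxP /(_ _ _ ij) := Ut k.
by rewrite [LHS]mxE => ->; rewrite mulr0.
Qed.

(** The [p] joint eigenvalues equal to [lam] already account for the whole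
    multiplicity [p] of the root 0 of the shifted characteristic polynomial. One
    more index would make [X^(p+1)] divide it, although its coefficient at [X^p]
    is the determinant of [D] up to sign. *)
Lemma vcomb_neq_joint_eigenvalue d n p q (A : 'I_d -> 'M[C]_n) U
    (lam mu : 'rV[C]_d) (D : 'M[C]_q) :
  triangularizing_unitary A U -> joint_algebraic_mult A U lam = p ->
  char_poly (mxcomb mu A - (vcomb mu lam)%:M) = 'X^p * char_poly D ->
  D \in unitmx ->
  forall j, joint_eigenvalue A U j != lam ->
    vcomb mu (joint_eigenvalue A U j) != vcomb mu lam.
Proof.
move=> tri mult cp Du j nlam; apply/eqP => same.
pose t i := vcomb mu (joint_eigenvalue A U i) - vcomb mu lam.
pose J := j |: [set i | joint_eigenvalue A U i == lam].
have cardJ : #|J| = p.+1 by rewrite cardsU1 inE nlam -mult.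
have tJ i : i \in J -> t i = 0.
  by rewrite !inE /t => /orP[/eqP->|/eqP->]; rewrite ?same subrr.
have : ('X^p * char_poly D)`_p = 0.
  rewrite -cp (char_poly_mxcomb _ _ tri) (bigID (fun i => i \in J)) /=.
  rewrite (eq_bigr (fun=> 'X)) => [|i iJ]; last by rewrite -/(t i) tJ // polyC0 subr0.
  by rewrite prodr_const cardJ coefXnM ltnSn.
rewrite coefXnM ltnn subnn char_poly_det => /eqP.
rewrite mulf_eq0 signr_eq0 /= => /eqP D0.
by move: Du; rewrite unitmxE D0 unitr0.
Qed.

Lemma bigmin_pos_fine (I : finType) (P : pred I) (f : I -> R) (i : I) :
  (forall j, P j -> 0 < f j) -> P i ->
  0 < fine (\big[Order.min/+oo%E]_(j | P j) (f j)%:E) <= f i.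
Proof.
move=> fpos Pi; set m := \big[_/_]_(_ | _) _.
have m_le : (m <= (f i)%:E)%E by exact: (bigmin_le_cond _ (fun j => (f j)%:E) Pi).
have m_gt : (0%:E < m)%E by apply: lt_bigmin => [|j Pj]; rewrite ?ltry // lte_fin fpos.
by move: m_le m_gt; case: m => // r; rewrite lee_fin lte_fin => -> ->.
Qed.

Lemma joint_gap_bound d n (A : 'I_d -> 'M[C]_n) U (lam mu : 'rV[C]_d) (i : 'I_n) (k : 'I_d) :
  (forall j, joint_eigenvalue A U j != lam ->
    vcomb mu (joint_eigenvalue A U j) != vcomb mu lam) ->
  cmod (joint_eigenvalue A U i 0 k - lam 0 k) <=
  (joint_gap A U lam mu)^-1 * cmod (vcomb mu (joint_eigenvalue A U i) - vcomb mu lam).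
Proof.
move=> neq; have [->|nlam] := eqVneq (joint_eigenvalue A U i) lam.
  by rewrite !subrr cmod0 mulr0.
have npos j : joint_eigenvalue A U j != lam -> 0 < fnorm (joint_eigenvalue A U j - lam).
  by move=> jl; rewrite lt_neqAle fnorm_ge0 andbT eq_sym fnorm_eq0 subr_eq0.
have /andP[g0 gle] : 0 < joint_gap A U lam mu <=
    cmod (vcomb mu (joint_eigenvalue A U i) - vcomb mu lam)
      / fnorm (joint_eigenvalue A U i - lam).
  apply: (bigmin_pos_fine (P := fun j => joint_eigenvalue A U j != lam)
   (f := fun j => cmod (vcomb mu (joint_eigenvalue A U j) - vcomb mu lam)
      / fnorm (joint_eigenvalue A U j - lam))) => // j jl.
  by rewrite divr_gt0 ?npos // lt_neqAle cmod_ge0 andbT eq_sym cmod_eq0 subr_eq0 neq.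
rewrite mulrC ler_pdivlMr // mulrC.
move: gle; rewrite ler_pdivlMr ?npos //; apply: le_trans.
rewrite (ler_wpM2l (ltW g0)) //.
rewrite -(@ler_pXn2r _ 2) ?nnegrE ?fnorm_ge0 ?cmod_ge0 //.
rewrite fnorm_row_sqr (bigD1 k) //= !mxE lerDl sumr_ge0 // => l _.
exact: sqr_ge0.
Qed.

End JointEigenvaluesTheory.

(** * The perturbation theorem *)

Theorem theorem4p2 (R : realType) (d p q : nat)
  (A : 'I_d -> 'M[R[i]]_(p + q)) (hA : commuting_family A)
  (U : 'M[R[i]]_(p + q)) (hU : triangularizing_unitary A U)
  (lam : 'rV[R[i]]_d) (hlam : semisimple_joint_eigenvalue A U lam p)
  (X1 Y1 : 'M[R[i]]_(p + q, p)) (X2 Y2 : 'M[R[i]]_(p + q, q))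
  (A22 : 'I_d -> 'M[R[i]]_q)
  (hX : row_mx X1 X2 \in unitmx) (hY : row_mx Y1 Y2 \in unitmx)
  (hX1 : X1 ^t* *m X1 = 1%:M)
  (hYX : (row_mx Y1 Y2) ^t* *m row_mx X1 X2 = 1%:M)
  (hblock : forall k : 'I_d,
     (row_mx Y1 Y2) ^t* *m A k *m row_mx X1 X2 =
     block_mx (lam 0 k)%:M 0 0 (A22 k))
  (mu : 'rV[R[i]]_d) (hmu : fnorm mu = 1)
  (hA22 : ~~ eigenvalue (mxcomb mu A22) (vcomb mu lam))
  (E : 'I_d -> 'M[R[i]]_(p + q)) (hE : \sum_k fnorm (E k) ^+ 2 = 1) :
  (exists K : R, \forall eps \near 0^'+,
     forall Xt Yt : 'M[R[i]]_(p + q, p),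
     closest_semisimple_eigenvectors
       (mxcomb mu (perturbed A E eps)) (vcomb mu lam) Xt Yt ->
     forall i : 'I_p,
     fnorm (rayleigh (perturbed A E eps) (col i Yt) (col i Xt) - lam)
       <= fnorm (col i Yt) * eps + K * eps ^+ 2)
  /\
  (simultaneously_diagonalizable A ->
   (forall k : 'I_d,
      is_diag_mx ((row_mx Y1 Y2) ^t* *m A k *m row_mx X1 X2)) ->
   exists K : R, \forall eps \near 0^'+,
     forall Xt Yt : 'M[R[i]]_(p + q, p),
     closest_semisimple_eigenvectors
       (mxcomb mu (perturbed A E eps)) (vcomb mu lam) Xt Yt ->
     forall i : 'I_p,
     fnorm (rayleigh (perturbed A E eps) (col i Xt) (col i Xt) - lam)
       <= (1 + Num.sqrt d%:R * spectral_norm X2 * spectral_norm Y2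
               / joint_gap A U lam mu) * eps + K * eps ^+ 2).
Proof.
rewrite tr_row_mx map_col_mx in hYX hblock *.
have hdec k := block_decomposition hYX (hblock k).
set D := mxcomb mu A22 - (vcomb mu lam)%:M.
have Du : D \in unitmx.
  move: hA22; rewrite /eigenvalue negbK /eigenspace kermx_eq0 -row_free_unit.
  by [].
split; first exact: two_sided_bound hYX hX1 hdec Du hmu hE.
move=> _ hdiag; have A22diag k : is_diag_mx (A22 k).
  apply/is_diag_mxP => i j ij; have := is_diag_mxP (hdiag k) (rshift p i) (rshift p j).
  by rewrite hblock block_mxEdr /= eqn_add2l => /(_ ij).
have [_ mult _] := hlam.
(* The unperturbed combination, as the case eps = 0 of the perturbed one. *)
have comb0 : mxcomb mu A = mxcomb mu (perturbed A (fun=> 0) 0).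
  by apply: eq_bigr => k _; rewrite /perturbed scaler0 addr0.
have cp : char_poly (mxcomb mu A - (vcomb mu lam)%:M) = 'X^p * char_poly D.
  rewrite -(char_poly_offspace D hYX) comb0 (mxcomb_decomposition _ _ _ hdec).
  by rewrite scale0r addr0 addrC addKr.
have neq := vcomb_neq_joint_eigenvalue hU mult cp Du.
have WX2 : Y2 ^t* *m X2 = 1%:M.
  by move: hYX; rewrite mul_col_row scalar_mx_block => /eq_block_mx[].
(* Column j of X2 is a common eigenvector, with the j-th diagonal entries. *)
have gap (k : 'I_d) (j : 'I_q) :
    cmod (A22 k j j - lam 0 k) <= (joint_gap A U lam mu)^-1 * cmod (D j j).
  have [i hi] : exists i, joint_eigenvalue A U i = \row_l A22 l j j.
    apply: (joint_eigenvalue_of_eigvec (v := X2 *m delta_mx j 0)) hU _ _.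
      apply/eqP => /(congr1 (mulmx (Y2 ^t*))).
      rewrite mulmxA WX2 mul1mx mulmx0 => /colP /(_ j) /eqP.
      by rewrite !mxE !eqxx oner_eq0.
    move=> l; rewrite hdec mxE mulmxDl mul_scalar_mx -!mulmxA (mulmxA (Y2 ^t*)) WX2 mul1mx.
    have -> : (A22 l - (lam 0 l)%:M) *m delta_mx j 0 =
        (A22 l j j - lam 0 l) *: (delta_mx j 0 : 'cV_q).
      rewrite -colE; apply/colP => i; rewrite !mxE eqxx andbT.
      have [->|ij] := eqVneq i j; first by rewrite mulr1n mulr1.
      by rewrite (is_diag_mxP (A22diag l)) // mulr0n subr0 mulr0.
    by rewrite -scalemxAr -scalerDl addrC subrK.
  have := joint_gap_bound i k neq; rewrite hi mxE.
  suff -> : D j j = vcomb mu (\row_l A22 l j j) - vcomb mu lam by [].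
  rewrite !mxE eqxx mulr1n /mxcomb summxE; congr (_ - _).
  by apply: eq_bigr => l _; rewrite !mxE.
have g0 : 0 <= (joint_gap A U lam mu)^-1.
  rewrite invr_ge0 /joint_gap; apply: fine_ge0; apply: le_bigmin => [|j _]; first exact: leey.
  by rewrite lee_fin divr_ge0 ?cmod_ge0 ?fnorm_ge0.
exact: one_sided_bound hYX hX1 hdec Du A22diag g0 gap hmu hE.
Qed.
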